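(* Let ${}_{0}^{\rho}\mathcal{I}_{\gamma,\beta,\alpha}^{\delta,p,q}f(t)$ and ${}_{i}^{\rho}\mathcal{V}_{\gamma,\beta,\alpha}^{\delta,p,q}f(t)$ be the $\mathcal{V}$-fractional integral and derivative of order $\alpha$, $0<\alpha<1$, with $a=0$, and let the function be $f(t)=(t-x)^{\mu}$, $t>x$ and $\mu>-1$. Then $${}_{i}^{\rho}\mathcal{V}_{\gamma,\beta,\alpha}^{\delta,p,q}\Big({}_{0}^{\rho}\mathcal{I}_{\gamma,\beta,\alpha}^{\delta,p,q}(t-x)^{\mu}\Big)=\frac{\Gamma(\mu+1-\alpha)\,\Gamma(\alpha)}{\Gamma(\mu+1+\alpha)}\,t^{\alpha}(\mu+\alpha)\,\mathcal{D}^{\alpha}t^{\mu},$$ where $\mathcal{D}^{\alpha}t^{\mu}$ is the Riemann-Liouville fractional derivative of order $\alpha$ of $t^{\mu}$.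
   Context: Let $\gamma,\beta,\rho,\delta\in\mathbb{C}$ and $p,q>0$ be such that $\mathrm{Re}(\gamma)>0$, $\mathrm{Re}(\beta)>0$, $\mathrm{Re}(\rho)>0$, $\mathrm{Re}(\delta)>0$, $\mathrm{Re}(\gamma)+p\ge q$. Here $(\rho)_{s}=\Gamma(\rho+s)/\Gamma(\rho)$ and $(\delta)_{s}=\Gamma(\delta+s)/\Gamma(\delta)$ are (generalized) Pochhammer symbols. The truncated function, with the index $i$ being the upper limit of summation, is $${}_{i}H_{\gamma,\beta,p}^{\rho,\delta,q}(z):=\Gamma(\beta)\sum_{k=0}^{i}\frac{(\rho)_{qk}}{(\delta)_{pk}}\frac{z^k}{\Gamma(\gamma k+\beta)}.$$ The truncated $\mathcal{V}$-fractional derivative of order $\alpha$ of a function $h$ is defined, for $t>0$, by $${}_{i}^{\rho}\mathcal{V}_{\gamma,\beta,\alpha}^{\delta,p,q}h(t):=\lim_{\epsilon\to 0}\frac{h\big(t\,{}_{i}H_{\gamma,\beta,p}^{\rho,\delta,q}(\epsilon t^{-\alpha})\big)-h(t)}{\epsilon}.$$ The $\mathcal{V}$-fractional integral with $a=0$ of order $\alpha$ is ${}_{0}^{\rho}\mathcal{I}_{\gamma,\beta,\alpha}^{\delta,p,q}f(t)=\frac{\Gamma(\gamma+\beta)(\delta)_p}{\Gamma(\beta)(\rho)_q}\int_0^t f(x)\,x^{\alpha-1}dx$; for $(t-x)^{\mu}$ the variable $x$ is the integration variable, that is, $${}_{0}^{\rho}\mathcal{I}_{\gamma,\beta,\alpha}^{\delta,p,q}(t-x)^{\mu}=\frac{\Gamma(\gamma+\beta)(\delta)_p}{\Gamma(\beta)(\rho)_q}\int_0^t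 (t-x)^{\mu}x^{\alpha-1}\,dx,$$ and the derivative acts on this as a function of $t$. The Riemann-Liouville fractional derivative of order $\alpha$, $0<\alpha<1$, is $\mathcal{D}^{\alpha}h(t)=\frac{1}{\Gamma(1-\alpha)}\frac{d}{dt}\int_0^t (t-s)^{-\alpha}h(s)\,ds$.
   Formalization: The formal theorem assumes i ≥ 1 (for i = 0 the truncated function is constant, so the derivative is 0 and the formula fails, e.g. at μ = 0) and μ ≠ α − 1 (there the factor Γ(μ+1−α) is undefined). *)

(* Defs.v *)
From Stdlib Require Import Reals Lra Lia ZArith.
From Coquelicot Require Import Coquelicot.
Open Scope R_scope.
Open Scope C_scope.

(* Principal argument, with values in (-PI, PI] for z <> 0. *)
Definition Carg (z : C) : R :=
  if Rlt_dec 0 (Re z) then atan (Im z / Re z)%R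
  else if Rlt_dec 0 (Im z) then (PI / 2 - atan (Re z / Im z))%R
  else if Rlt_dec (Im z) 0 then (- (PI / 2) - atan (Re z / Im z))%R
  else PI.

Definition Cln (z : C) : C := (ln (Cmod z), Carg z).

Definition Cexp (z : C) : C :=
  ((exp (Re z) * cos (Im z))%R, (exp (Re z) * sin (Im z))%R).

(* Principal branch of z ^ w; the value at z = 0 is irrelevant. *)
Definition Cpower (z w : C) : C := Cexp (w * Cln z).

(* Euler's integral; it converges for 0 < Re z. *)
Definition Gamma_integral (z : C) : C :=
  @RInt_gen C_R_CompleteNormedModule
    (fun t : R => RtoC (exp (- t)) * Cpower (RtoC t) (z - 1))
    (at_right 0) (Rbar_locally p_infty).

(* z (z + 1) ... (z + n - 1) *)
Fixpoint rising (z : C) (n : nat) : C :=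
  match n with
  | O => 1
  | S m => rising z m * (z + RtoC (INR m))
  end.

(* The least number of unit steps to the right that bring z into 0 < Re. *)
Definition Gamma_shift (z : C) : nat := Z.to_nat (up (- Re z)).

(* The Gamma function on C minus the non-positive integers: Euler's integral,
   continued to Re z <= 0 by Gamma (z + 1) = z * Gamma z.  The value at the
   poles is meaningless. *)
Definition Gamma (z : C) : C :=
  Gamma_integral (z + RtoC (INR (Gamma_shift z))) / rising z (Gamma_shift z).

(* (rho)_s for a real, not necessarily integer, index s. *)
Definition pochhammer (rho : C) (s : R) : C := Gamma (rho + RtoC s) / Gamma rho.

Definition truncH (i : nat) (gamma beta rho delta : C) (p q : R) (z : C) : C :=
  Gamma beta *
  sum_n (fun k : nat =>
    pochhammer rho (q * INR k) / pochhammer delta (p * INR k)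
    * (Cpow z k / Gamma (gamma * RtoC (INR k) + beta))) i.

(* The limit defining the derivative of h at t > 0 exists and equals l.  The
   increment eps is real; as the parameters of truncH are complex, h is
   evaluated at complex points near t. *)
Definition is_V_derivative (i : nat) (gamma beta rho delta : C)
    (p q alpha : R) (h : C -> C) (t : R) (l : C) : Prop :=
  filterlim
    (fun eps : R =>
       (h (RtoC t *
           truncH i gamma beta rho delta p q (RtoC (eps * Rpower t (- alpha))))
        - h (RtoC t)) / RtoC eps)
    (locally' 0) (locally l).

(* Integral of f along the segment from 0 to z, improper at both ends.  For
   z = t > 0 it is the integral of f over (0, t). *)
Definition segment_integral (f : C -> C) (z : C) : C :=
  z * @RInt_gen C_R_CompleteNormedModule
        (fun s : R => f (RtoC s * z)) (at_right 0) (at_left 1).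

Definition V_integral (gamma beta rho delta : C) (p q alpha : R)
    (f : C -> C) (z : C) : C :=
  Gamma (gamma + beta) * pochhammer delta p / (Gamma beta * pochhammer rho q)
  * segment_integral (fun x : C => f x * Cpower x (RtoC (alpha - 1))) z.

(* Riemann-Liouville fractional derivative of order alpha, 0 < alpha < 1. *)
Definition RL_derivative (alpha : R) (h : R -> R) (t : R) : C :=
  / Gamma (RtoC (1 - alpha))
  * RtoC (Derive (fun u : R =>
      RInt_gen (fun s : R => (Rpower (u - s) (- alpha) * h s)%R)
        (at_right 0) (at_left u)) t).

Lemma Cpower_real (x a : R) :
  (0 < x)%R -> Cpower (RtoC x) (RtoC a) = RtoC (Rpower x a).
Proof.
intros Hx; unfold Cpower, Cexp, Cln, Carg, Rpower, RtoC, Cmult; simpl.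
destruct (Rlt_dec 0 x) as [_|H]; [|lra].
replace (0 / x)%R with 0%R by (field; lra).
change (x, 0%R) with (RtoC x).
rewrite atan_0, Cmod_R, (Rabs_pos_eq x) by lra.
replace (a * 0 + 0 * ln x)%R with 0%R by ring.
rewrite cos_0, sin_0.
replace (a * ln x - 0 * 0)%R with (a * ln x)%R by ring.
f_equal; ring.
Qed.

Lemma Gamma_Euler (z : C) : (0 < Re z)%R -> Gamma z = Gamma_integral z.
Proof.
intros Hz; unfold Gamma.
assert (H : Gamma_shift z = O).
{ unfold Gamma_shift.
  assert (Hu : (up (- Re z) < 1)%Z).
  { apply lt_IZR; destruct (archimed (- Re z)); simpl; lra. }
  lia. }
rewrite H; simpl.
replace (z + 0) with z by ring.
field.
Qed.

(* Main.v *)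
Require Import Defs.
From Stdlib Require Import Reals Factorial Lra Lia ssreflect.
From Coquelicot Require Import Coquelicot.
Open Scope R_scope.

(* For [Re z > 0] one has (z - s z)^mu = z^mu (1 - s)^mu, so the integral equals
   K B(alpha, mu + 1) z^(mu + alpha) with K the constant in front of it.  The
   path eps |-> t H(eps t^(-alpha)) starts at t with velocity t^(1 - alpha) / K,
   so the chain rule gives B(alpha, mu + 1) (mu + alpha) t^mu.  The right-hand
   side is the same by D^alpha t^mu = Gamma(mu + 1) / Gamma(mu + 1 - alpha)
   t^(mu - alpha) and B(a, b) = Gamma(a) Gamma(b) / Gamma(a + b).

   Cancelling K needs that Gamma has no zero in the right half plane.  This and
   the Beta-Gamma relation both come from the limit
   N^z B(z, N + 1) --> Gamma(z) for real N --> oo: at integers it is Gauss's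
   product, whose factors are bounded from below uniformly, and along N = n + b
   it is combined with the recursion (z + b) B(z, b + 1) = b B(z, b). *)

(* [ring] and [field] fail when the carrier is displayed as that of
   [C_R_NormedModule] instead of [C]. *)
Ltac as_C_eq := match goal with |- ?l = ?r => change (@eq C l r) end.

(** With complex parameters the path leaves the real axis, so the integral has to be known at
    complex points near [t]. Differentiation nevertheless stays along the real variable, one
    coordinate at a time, in the real normed space underlying [C]. Complex arguments of Gamma matter
    only for its nonvanishing, while the Beta integrals in the final identity have real arguments.
    [Beta] therefore takes a complex first and a real second argument, which covers both uses. The
    limit stands in for the usual double integral behind the Beta-Gamma relation, and its real index
    makes room for the shift by a real [b]. When mu + 1 - alpha is negative, Gamma is there a
    continued value, and the recursion at that point comes from the definition instead of an
    integral. *)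

(** * Improper integrals through limits of primitives *)

(** Each proper integral is an increment of [Phi]. Order convexity of [D], in practice (0, 1) or (0,
    oo), keeps the whole interval inside the domain once its ends are there, whatever their
    order. *)
Lemma is_RInt_gen_primitive {V : CompleteNormedModule R_AbsRing}
    {Fa Fb : (R -> Prop) -> Prop} {FFa : Filter Fa} {FFb : Filter Fb}
    (D : R -> Prop) (Phi f : R -> V) (la lb : V) :
  (forall x y z, D x -> D z -> x <= y <= z -> D y) -> Fa D -> Fb D ->
  (forall x, D x -> is_derive Phi x (f x)) ->
  (forall x, D x -> continuous f x) ->
  filterlim Phi Fa (locally la) -> filterlim Phi Fb (locally lb) ->
  is_RInt_gen f Fa Fb (minus lb la).
Proof.
intros Dc Da Db dPhi cf Ha Hb.
assert (Hd : forall a b, D a -> D b ->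
  forall x, Rmin a b <= x <= Rmax a b -> D x).
{ intros a b Ra Rb x Hx; destruct (Rle_dec a b) as [ab|ab].
  - rewrite (Rmin_left _ _ ab) (Rmax_right _ _ ab) in Hx; exact (Dc a x b Ra Rb Hx).
  - apply Rnot_le_lt, Rlt_le in ab.
    rewrite (Rmin_right _ _ ab) (Rmax_left _ _ ab) in Hx; exact (Dc b x a Rb Ra Hx). }
assert (Hlim : filterlim (fun ab : R * R => minus (Phi (snd ab)) (Phi (fst ab)))
  (filter_prod Fa Fb) (locally (minus lb la))).
{ unfold minus; eapply filterlim_comp_2; [| |apply: filterlim_plus].
  - eapply filterlim_comp; [apply filterlim_snd|exact Hb].
  - eapply filterlim_comp;
      [eapply filterlim_comp; [apply filterlim_fst|exact Ha]|].
    apply: filterlim_opp. }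
intros P HP.
assert (HD : filter_prod Fa Fb (fun ab => D (fst ab) /\ D (snd ab)))
  by (exists D D; auto).
refine (filter_imp _ _ _ (filter_and _ _ HD
  (Hlim P HP : filter_prod Fa Fb (fun ab => P (minus (Phi (snd ab)) (Phi (fst ab))))))).
intros [a b] [[Ra Rb] Hab]; exists (minus (Phi b) (Phi a)); split; [|exact Hab].
apply is_RInt_derive; intros x Hx; [apply dPhi|apply cf]; exact (Hd a b Ra Rb x Hx).
Qed.

Lemma is_derive_primitive {V : CompleteNormedModule R_AbsRing}
    (D : R -> Prop) (f : R -> V) (c x : R) :
  (forall x y z, D x -> D z -> x <= y <= z -> D y) -> open D ->
  (forall x, D x -> continuous f x) -> D c -> D x ->
  is_derive (fun y => RInt f c y) x (f x).
Proof.
intros Dc Do cf Hc Hx; apply: is_derive_RInt; [|exact (cf x Hx)].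
refine (filter_imp _ _ _ (Do x Hx)); intros y Hy.
apply RInt_correct, ex_RInt_continuous; intros z Hz; apply cf.
destruct (Rle_dec c y) as [cy|cy].
- rewrite (Rmin_left _ _ cy) (Rmax_right _ _ cy) in Hz; exact (Dc c z y Hc Hy Hz).
- apply Rnot_le_lt, Rlt_le in cy.
  rewrite (Rmin_right _ _ cy) (Rmax_left _ _ cy) in Hz; exact (Dc y z c Hy Hc Hz).
Qed.

(** Increments of [Phi] are bounded by those of [G]; since [G] converges, [Phi] is Cauchy, and
    completeness yields a limit without a formula for it. *)
Lemma primitive_limit_dominated {V : CompleteNormedModule R_AbsRing}
    {F : (R -> Prop) -> Prop} {FF : ProperFilter F}
    (D : R -> Prop) (Phi f : R -> V) (G g : R -> R) (lG : R) :
  (forall x y z, D x -> D z -> x <= y <= z -> D y) -> F D ->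
  (forall x, D x -> is_derive Phi x (f x)) ->
  (forall x, D x -> continuous f x) ->
  (forall x, D x -> is_derive G x (g x)) ->
  (forall x, D x -> continuous g x) ->
  (forall x, D x -> norm (f x) <= g x) ->
  filterlim G F (locally lG) ->
  exists l, filterlim Phi F (locally l).
Proof.
intros Dc HD dPhi cf dG cg Hle HG.
assert (Hord : forall x y, D x -> D y -> x <= y ->
  norm (minus (Phi y) (Phi x)) <= G y - G x).
{ intros x y Hx Hy Hxy.
  apply (norm_RInt_le f g x y); [exact Hxy| | |].
  - intros z Hz; apply Hle; exact (Dc x z y Hx Hy Hz).
  - apply is_RInt_derive; rewrite (Rmin_left _ _ Hxy) (Rmax_right _ _ Hxy);
      intros z Hz; [apply dPhi|apply cf]; exact (Dc x z y Hx Hy Hz).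
  - apply (is_RInt_derive (V := R_CompleteNormedModule));
      rewrite (Rmin_left _ _ Hxy) (Rmax_right _ _ Hxy);
      intros z Hz; [apply dG|apply cg]; exact (Dc x z y Hx Hy Hz). }
apply (proj1 (filterlim_locally_cauchy (F := F) Phi)); intros eps.
destruct (proj2 (filterlim_locally_cauchy (F := F) (U := R_CompleteSpace) G)
  (ex_intro _ lG HG) eps) as [P [HP HPe]].
exists (fun x => P x /\ D x); split; [apply filter_and; assumption|].
intros x y [Px Rx] [Py Ry]; apply: norm_compat1.
destruct (Rle_dec x y) as [xy|xy].
- eapply Rle_lt_trans; [apply Hord; assumption|].
  eapply Rle_lt_trans; [apply Rle_abs|exact (HPe x y Px Py)].
- rewrite <- norm_opp; rewrite opp_minus.
  eapply Rle_lt_trans; [apply Hord; [assumption|assumption|lra]|].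
  eapply Rle_lt_trans; [apply Rle_abs|exact (HPe y x Py Px)].
Qed.

(** Serves for multiplication by a complex constant and for the projections [Re] and [Im]. *)
Lemma is_RInt_gen_map {U V : NormedModule R_AbsRing}
    {Fa Fb : (R -> Prop) -> Prop} {FFa : Filter Fa} {FFb : Filter Fb}
    (L : U -> V) (f : R -> U) (l : U) :
  (forall a b l', is_RInt f a b l' -> is_RInt (fun x => L (f x)) a b (L l')) ->
  continuous L l ->
  is_RInt_gen f Fa Fb l -> is_RInt_gen (fun x => L (f x)) Fa Fb (L l).
Proof.
intros HL cL Hf P HP.
assert (H := Hf _ (cL P HP)); unfold filtermapi in *; revert H; apply: filter_imp.
intros ab [l' [Hl' HPl']]; exists (L l'); auto.
Qed.

(** * Complex-valued functions of a real variable *)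

Lemma norm_C (z : C) : @norm _ C_R_NormedModule z = Cmod z.
Proof.
destruct z as [x y]; unfold norm, Cmod; simpl; unfold prod_norm, norm; simpl.
unfold abs; simpl; f_equal; rewrite !Rmult_1_r.
rewrite -!Rabs_mult !Rabs_pos_eq; [reflexivity| |]; apply Rle_0_sqr.
Qed.

(** Rests on z = Re z * 1 + Im z * i: two real functions times fixed vectors. *)
Lemma is_derive_C (f : R -> C) (x : R) (l : C) :
  is_derive (fun t => Re (f t)) x (Re l) ->
  is_derive (fun t => Im (f t)) x (Im l) ->
  is_derive (V := C_R_NormedModule) f x l.
Proof.
intros Hr Hi.
generalize (is_derive_plus _ _ _ _ _
  (is_derive_scal_l (V := C_R_NormedModule) _ x _ (RtoC 1) Hr)
  (is_derive_scal_l (V := C_R_NormedModule) _ x _ Ci Hi)).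
assert (E : forall z : C, @plus C_R_NormedModule
  (@scal _ C_R_NormedModule (Re z) (RtoC 1)) (@scal _ C_R_NormedModule (Im z) Ci) = z).
{ intros [a b]; unfold plus, scal; simpl; unfold prod_plus, prod_scal, plus, scal; simpl.
  unfold mult; simpl; f_equal; ring. }
rewrite E; apply is_derive_ext; intros t; apply E.
Qed.

Lemma is_derive_Re (f : R -> C) (x : R) (l : C) :
  is_derive (V := C_R_NormedModule) f x l -> is_derive (fun t => Re (f t)) x (Re l).
Proof.
intros Hf.
refine (filterdiff_ext_lin _ _ _ (filterdiff_comp' f fst x _ _ Hf
  (filterdiff_linear (K := R_AbsRing) (U := C_R_NormedModule) (V := R_NormedModule)
    _ is_linear_fst)) _).
intros y; reflexivity.
Qed.

Lemma is_derive_Im (f : R -> C) (x : R) (l : C) :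
  is_derive (V := C_R_NormedModule) f x l -> is_derive (fun t => Im (f t)) x (Im l).
Proof.
intros Hf.
refine (filterdiff_ext_lin _ _ _ (filterdiff_comp' f snd x _ _ Hf
  (filterdiff_linear (K := R_AbsRing) (U := C_R_NormedModule) (V := R_NormedModule)
    _ is_linear_snd)) _).
intros y; reflexivity.
Qed.

Lemma is_derive_Cmult (f g : R -> C) (x : R) (f' g' : C) :
  is_derive (V := C_R_NormedModule) f x f' ->
  is_derive (V := C_R_NormedModule) g x g' ->
  is_derive (V := C_R_NormedModule) (fun t => Cmult (f t) (g t)) x
    (f' * g x + f x * g')%C.
Proof.
intros Hf Hg.
generalize (is_derive_Re _ _ _ Hf) (is_derive_Im _ _ _ Hf)
  (is_derive_Re _ _ _ Hg) (is_derive_Im _ _ _ Hg).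
intros fr fi gr gi.
apply is_derive_C; simpl.
- evar_last.
  + apply: is_derive_minus; apply: is_derive_mult; try eassumption; apply Rmult_comm.
  + unfold Re, Im, minus, plus, opp, mult; simpl; ring.
- evar_last.
  + apply: is_derive_plus; apply: is_derive_mult; try eassumption; apply Rmult_comm.
  + unfold Re, Im, minus, plus, opp, mult; simpl; ring.
Qed.

Lemma is_derive_RtoC (f : R -> R) (x l : R) :
  is_derive f x l -> is_derive (V := C_R_NormedModule) (fun t => RtoC (f t)) x (RtoC l).
Proof.
intros Hf; apply is_derive_C; simpl; [exact Hf|apply: is_derive_const].
Qed.

(** * Complex and real powers *)

Lemma Cpower_pos (x : R) (z : C) :
  0 < x -> Cpower (RtoC x) z =
    (exp (Re z * ln x) * cos (Im z * ln x), exp (Re z * ln x) * sin (Im z * ln x)).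
Proof.
intros Hx; unfold Cpower, Cexp, Cln, Carg, RtoC, Cmult; simpl.
destruct (Rlt_dec 0 x) as [_|H]; [|lra].
change (x, 0) with (RtoC x); rewrite Cmod_R (Rabs_pos_eq x); [|lra].
replace (0 / x) with 0 by (field; lra); rewrite atan_0.
f_equal; f_equal; f_equal; unfold Re, Im; ring.
Qed.

Lemma is_derive_Cpower (x : R) (z : C) :
  0 < x -> is_derive (V := C_R_NormedModule) (fun t => Cpower (RtoC t) z) x
    (z * Cpower (RtoC x) (z - 1))%C.
Proof.
intros Hx.
assert (Hl : locally x (fun y => 0 < y)) by exact (open_gt 0 x Hx).
apply: is_derive_ext_loc; [apply: filter_imp Hl; intros y Hy; symmetry; exact (Cpower_pos y z Hy)|].
rewrite (Cpower_pos _ _ Hx).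
assert (E : exp (Re (z - 1)%C * ln x) = exp (Re z * ln x) / x).
{ destruct z as [a b]; unfold Re; simpl.
  replace ((a + - (1)) * ln x) with (a * ln x + - ln x) by ring.
  rewrite exp_plus exp_Ropp exp_ln; [reflexivity|exact Hx]. }
rewrite E; destruct z as [a b]; unfold Re, Im; simpl.
rewrite Ropp_0 Rplus_0_r.
apply is_derive_C; unfold Re, Im; simpl; auto_derive; auto; field; lra.
Qed.

Lemma Cexp_plus (z w : C) : Cexp (z + w) = (Cexp z * Cexp w)%C.
Proof.
destruct z as [a b], w as [c d]; unfold Cexp, Cmult; simpl.
rewrite exp_plus cos_plus sin_plus; f_equal; ring.
Qed.

Lemma Cpower_plus (z a b : C) : Cpower z (a + b) = (Cpower z a * Cpower z b)%C.
Proof.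
unfold Cpower; rewrite Cmult_plus_distr_r; apply Cexp_plus.
Qed.

(** A positive factor leaves the argument unchanged, and the half plane keeps both points in the
    arctangent case of [Carg], so no branch is crossed. *)
Lemma Cpower_scale (s : R) (z w : C) : 0 < s -> 0 < Re z ->
  Cpower (RtoC s * z) w = (Cpower (RtoC s) w * Cpower z w)%C.
Proof.
intros Hs Hz; unfold Cpower; rewrite -Cexp_plus -Cmult_plus_distr_l; f_equal; f_equal.
destruct z as [x y]; unfold Re in Hz; simpl in Hz.
unfold Cln, Carg; rewrite Cmod_mult Cmod_R ln_mult.
- rewrite -Cmod_R; unfold Cplus; simpl.
  replace (s * x - 0 * y) with (s * x) by ring.
  replace (s * y + 0 * x) with (s * y) by ring.
  destruct (Rlt_dec 0 (s * x)) as [_|H]; [|nra].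
  destruct (Rlt_dec 0 s) as [_|H]; [|lra].
  destruct (Rlt_dec 0 x) as [_|H]; [|lra].
  f_equal; replace (0 / s) with 0 by (field; lra); rewrite atan_0 Rplus_0_l.
  f_equal; field; lra.
- rewrite Rabs_pos_eq; lra.
- apply Cmod_gt_0; intros E; apply (f_equal fst) in E; simpl in E; lra.
Qed.

Lemma Cpower_step (x : R) (z : C) :
  0 < x -> Cpower (RtoC x) z = (RtoC x * Cpower (RtoC x) (z - 1))%C.
Proof.
intros Hx; rewrite !Cpower_pos //; destruct z as [a b]; unfold Re, Im, Cmult; simpl.
replace (a * ln x) with (ln x + (a + - (1)) * ln x) by ring.
rewrite exp_plus exp_ln // Ropp_0 Rplus_0_r.
f_equal; ring.
Qed.

Lemma Rpower_step (x b : R) : 0 < x -> Rpower x b = x * Rpower x (b - 1).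
Proof.
intros Hx; rewrite -{2}(Rpower_1 x Hx) -Rpower_plus; f_equal; ring.
Qed.

Lemma Cmod_Cpower (x : R) (z : C) : 0 < x -> Cmod (Cpower (RtoC x) z) = Rpower x (Re z).
Proof.
intros Hx; rewrite Cpower_pos //; unfold Cmod, Rpower; simpl fst; simpl snd.
set (e := exp _); set (u := Im z * ln x).
replace ((e * cos u) ^ 2 + (e * sin u) ^ 2) with (e ^ 2 * (Rsqr (sin u) + Rsqr (cos u)))
  by (unfold Rsqr; ring).
rewrite sin2_cos2 Rmult_1_r sqrt_pow2 //; apply Rlt_le, exp_pos.
Qed.

Lemma Rpower_pos (x y : R) : 0 < Rpower x y.
Proof. apply exp_pos. Qed.

Lemma exp_le_exp (x y : R) : x <= y -> exp x <= exp y.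
Proof.
intros [H| ->]; [apply Rlt_le, exp_increasing, H|apply Rle_refl].
Qed.

(** For c >= 0 the bound is 1, for c < 0 it is the value at [m]; the sum serves both signs. *)
Lemma Rpower_bound (m x c : R) : 0 < m -> m <= x <= 1 -> Rpower x c <= Rpower m c + 1.
Proof.
intros Hm Hx; unfold Rpower.
assert (H1 : ln x <= 0) by (rewrite -ln_1; apply ln_le; lra).
assert (H2 : ln m <= ln x) by (apply ln_le; lra).
destruct (Rle_dec 0 c) as [Hc|Hc].
- assert (exp (c * ln x) <= 1); [|generalize (exp_pos (c * ln m)); lra].
  rewrite -exp_0; apply exp_le_exp; nra.
- assert (exp (c * ln x) <= exp (c * ln m)); [|lra].
  apply exp_le_exp; nra.
Qed.

Lemma Rpower_le_1 (x c : R) : 0 < x <= 1 -> 0 <= c -> Rpower x c <= 1.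
Proof.
intros Hx Hc; unfold Rpower; rewrite -exp_0; apply exp_le_exp.
assert (ln x <= 0) by (rewrite -ln_1; apply ln_le; lra); nra.
Qed.

Lemma is_derive_Rpower (x c : R) :
  0 < x -> is_derive (fun t => Rpower t c) x (c * Rpower x (c - 1)).
Proof.
intros Hx; apply is_derive_Reals, derivable_pt_lim_power; exact Hx.
Qed.

Lemma filterlim_Rpower_0 (c : R) :
  0 < c -> filterlim (fun t => Rpower t c) (at_right 0) (locally 0).
Proof.
intros Hc; apply filterlim_locally; intros eps.
exists (mkposreal _ (Rpower_pos eps (/ c))); intros y Hy Hy0.
unfold ball in *; simpl in *; unfold AbsRing_ball, abs, minus, plus, opp in *; simpl in *.
rewrite Ropp_0 Rplus_0_r Rabs_pos_eq in Hy; [|lra].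
rewrite Ropp_0 Rplus_0_r Rabs_pos_eq; [|apply Rlt_le, Rpower_pos].
replace (pos eps) with (Rpower (Rpower eps (/ c)) c).
- apply Rlt_Rpower_l; lra.
- rewrite Rpower_mult Rinv_l ?Rpower_1 //; [apply cond_pos|lra].
Qed.

Lemma filterlim_at_left_1 : filterlim (fun s => 1 - s) (at_left 1) (at_right 0).
Proof.
intros P [d Hd]; exists d; intros y Hy Hy1; apply Hd; [|lra].
unfold ball in *; simpl in *; unfold AbsRing_ball, abs, minus, plus, opp in *; simpl in *.
replace (1 - y + - 0) with (- (y + - (1))) by ring; now rewrite Rabs_Ropp.
Qed.

Lemma filterlim_Rpower_compl_0 (c : R) :
  0 < c -> filterlim (fun t => Rpower (1 - t) c) (at_left 1) (locally 0).
Proof.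
intros Hc; exact (filterlim_comp _ _ _ (fun t => 1 - t) (fun t => Rpower t c) _ _ _
  filterlim_at_left_1 (filterlim_Rpower_0 c Hc)).
Qed.

Lemma filterlim_C_zero {T : Type} {F : (T -> Prop) -> Prop} {FF : Filter F}
    (f : T -> C) (g : T -> R) :
  F (fun x => Cmod (f x) <= g x) -> filterlim g F (locally 0) ->
  filterlim f F (locally (RtoC 0)).
Proof.
intros Hle Hg; apply filterlim_locally; intros eps.
generalize (filter_and _ _ Hle (proj1 (filterlim_locally _ _) Hg eps)).
apply filter_imp; intros x [H1 H2].
apply: (@norm_compat1 _ C_R_NormedModule); rewrite norm_C.
unfold ball in H2; simpl in H2; unfold AbsRing_ball, abs, minus, plus, opp in H2; simpl in H2.
change (Cmod (f x - RtoC 0) < eps).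
replace (f x - RtoC 0)%C with (f x) by ring.
eapply Rle_lt_trans; [exact H1|]; eapply Rle_lt_trans; [apply Rle_abs|].
now rewrite Ropp_0 Rplus_0_r in H2.
Qed.

(** * The Beta integral *)

Definition beta_kernel (z : C) (b s : R) : C :=
  (Cpower (RtoC s) (z - 1) * RtoC (Rpower (1 - s) (b - 1)))%C.

Lemma is_derive_Rpower_compl (b s : R) : s < 1 ->
  is_derive (fun s => Rpower (1 - s) b) s (- (b * Rpower (1 - s) (b - 1))).
Proof.
intros Hs.
generalize (is_derive_comp (fun u => Rpower u b) (fun s => 1 - s) s _ (- (1))
  (is_derive_Rpower (1 - s) b ltac:(lra))).
intros H; evar_last; [apply H; auto_derive; auto; ring|].
unfold scal; simpl; unfold mult; simpl; ring.
Qed.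

Lemma continuous_beta_kernel (z : C) (b s : R) :
  0 < s < 1 -> continuous (U := C_R_NormedModule) (beta_kernel z b) s.
Proof.
intros Hs; apply: ex_derive_continuous; eexists; apply is_derive_Cmult.
- apply is_derive_Cpower; lra.
- apply is_derive_RtoC, is_derive_Rpower_compl; lra.
Qed.

Lemma Cmod_beta_kernel (z : C) (b s : R) :
  0 < s < 1 -> Cmod (beta_kernel z b s) = Rpower s (Re z - 1) * Rpower (1 - s) (b - 1).
Proof.
intros Hs; unfold beta_kernel.
rewrite Cmod_mult Cmod_Cpower ?Cmod_R; [|lra].
rewrite (Rabs_pos_eq (Rpower _ _)); [|apply Rlt_le, Rpower_pos].
now destruct z.
Qed.

Lemma open_Rlt_between (a b : R) : open (fun x => a < x < b).
Proof. apply open_and; [apply open_gt|apply open_lt]. Qed.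

Lemma at_right_between (a b : R) : a < b -> at_right a (fun x => a < x < b).
Proof.
intros Hab; assert (Hd : 0 < b - a) by lra.
exists (mkposreal _ Hd); intros y Hy Hy'; split; [exact Hy'|].
unfold ball in Hy; simpl in Hy; unfold AbsRing_ball, abs, minus, plus, opp in Hy; simpl in Hy.
apply Rabs_def2 in Hy; lra.
Qed.

Lemma at_left_between (a b : R) : a < b -> at_left b (fun x => a < x < b).
Proof.
intros Hab; assert (Hd : 0 < b - a) by lra.
exists (mkposreal _ Hd); intros y Hy Hy'; split; [|exact Hy'].
unfold ball in Hy; simpl in Hy; unfold AbsRing_ball, abs, minus, plus, opp in Hy; simpl in Hy.
apply Rabs_def2 in Hy; lra.
Qed.

Lemma filterlim_scal_0 {T : Type} {F : (T -> Prop) -> Prop} {FF : Filter F}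
    (c : R) (f : T -> R) :
  filterlim f F (locally 0) -> filterlim (fun x => c * f x) F (locally 0).
Proof.
intros Hf; rewrite -(Rmult_0_r c).
eapply filterlim_comp; [exact Hf|]; apply: (filterlim_scal_r c 0).
Qed.

(** On each half of (0, 1) the factor belonging to the other end is bounded by a constant [K], which
    leaves a pure power with an explicit primitive vanishing at the singular end. *)
Lemma ex_beta (z : C) (b : R) : 0 < Re z -> 0 < b ->
  exists l, is_RInt_gen (V := C_R_CompleteNormedModule) (beta_kernel z b)
    (at_right 0) (at_left 1) l.
Proof.
intros Hz Hb.
set (D := fun x => 0 < x < 1).
assert (Dc : forall x y z, D x -> D z -> x <= y <= z -> D y) by (unfold D; intros; lra).
set (Phi := fun x => @RInt C_R_CompleteNormedModule (beta_kernel z b) (1/2) x).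
assert (dPhi : forall x, D x -> is_derive (V := C_R_CompleteNormedModule) Phi x (beta_kernel z b x)).
{ intros x Hx; apply (is_derive_primitive (V := C_R_CompleteNormedModule) D); auto.
  - apply open_Rlt_between.
  - exact (continuous_beta_kernel z b).
  - unfold D; lra. }
assert (H0 : exists l, filterlim Phi (at_right 0) (locally (l : C_R_CompleteNormedModule))).
{ set (K := Rpower (1/2) (b - 1) + 1).
  apply (primitive_limit_dominated (fun x => 0 < x < 1 / 2) Phi (beta_kernel z b)
    (fun s => K / Re z * Rpower s (Re z)) (fun s => K * Rpower s (Re z - 1)) 0).
  - intros; lra.
  - apply at_right_between; lra.
  - intros x Hx; apply dPhi; unfold D; lra.
  - intros x Hx; apply continuous_beta_kernel; lra.
  - intros x Hx; evar_last; [apply: is_derive_scal; apply is_derive_Rpower; lra|].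
    unfold scal; simpl; unfold mult; simpl; field; lra.
  - intros x Hx; apply: ex_derive_continuous; eexists.
    apply: is_derive_scal; apply is_derive_Rpower; lra.
  - intros x Hx; rewrite norm_C Cmod_beta_kernel; [|lra].
    generalize (Rpower_bound (1/2) (1 - x) (b - 1)) (Rpower_pos x (Re z - 1)).
    fold K; intros H1 H2; specialize (H1 ltac:(lra) ltac:(lra)); nra.
  - apply filterlim_scal_0, filterlim_Rpower_0, Hz. }
assert (H1 : exists l, filterlim Phi (at_left 1) (locally (l : C_R_CompleteNormedModule))).
{ set (K := Rpower (1/2) (Re z - 1) + 1).
  apply (primitive_limit_dominated (fun x => 1 / 2 < x < 1) Phi (beta_kernel z b)
    (fun s => - (K / b) * Rpower (1 - s) b) (fun s => K * Rpower (1 - s) (b - 1)) 0).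
  - intros; lra.
  - apply at_left_between; lra.
  - intros x Hx; apply dPhi; unfold D; lra.
  - intros x Hx; apply continuous_beta_kernel; lra.
  - intros x Hx; evar_last; [apply: is_derive_scal; apply is_derive_Rpower_compl; lra|].
    unfold scal; simpl; unfold mult; simpl; field; lra.
  - intros x Hx; apply: ex_derive_continuous; eexists.
    apply: is_derive_scal; apply is_derive_Rpower_compl; lra.
  - intros x Hx; rewrite norm_C Cmod_beta_kernel; [|lra].
    generalize (Rpower_bound (1/2) x (Re z - 1)) (Rpower_pos (1 - x) (b - 1)).
    fold K; intros H1 H2; specialize (H1 ltac:(lra) ltac:(lra)); nra.
  - apply filterlim_scal_0.
    exact (filterlim_Rpower_compl_0 b Hb). }
destruct H0 as [l0 H0], H1 as [l1 H1]; exists (minus l1 l0).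
apply (is_RInt_gen_primitive (V := C_R_CompleteNormedModule) D Phi); auto.
- apply at_right_between; lra.
- apply at_left_between; lra.
- exact (continuous_beta_kernel z b).
Qed.

Definition Beta (z : C) (b : R) : C :=
  @RInt_gen C_R_CompleteNormedModule (beta_kernel z b) (at_right 0) (at_left 1).

Lemma is_RInt_gen_Beta (z : C) (b : R) : 0 < Re z -> 0 < b ->
  is_RInt_gen (V := C_R_CompleteNormedModule) (beta_kernel z b)
    (at_right 0) (at_left 1) (Beta z b).
Proof.
intros Hz Hb; exact (RInt_gen_correct (V := C_R_CompleteNormedModule) _ (ex_beta z b Hz Hb)).
Qed.

(** * Complex products under limits and integrals, and the recursion of Beta *)

Lemma is_linear_Cmult (c : C) :
  is_linear (K := R_AbsRing) (U := C_R_NormedModule) (V := C_R_NormedModule) (Cmult c).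
Proof.
split.
- intros x y; exact (Cmult_plus_distr_l c x y).
- intros k [x1 x2]; destruct c as [c1 c2].
  unfold Cmult, scal; simpl; unfold prod_scal, scal; simpl; unfold mult; simpl.
  f_equal; ring.
- exists (Cmod c + 1); split; [generalize (Cmod_ge_0 c); lra|intros x].
  rewrite !norm_C Cmod_mult; generalize (Cmod_ge_0 x); nra.
Qed.

Lemma filterlim_C {T : Type} {F : (T -> Prop) -> Prop} {FF : Filter F}
    (f : T -> C) (l : C) :
  filterlim (fun x => Re (f x)) F (locally (Re l)) ->
  filterlim (fun x => Im (f x)) F (locally (Im l)) ->
  filterlim f F (locally l).
Proof.
intros Hr Hi; apply filterlim_locally; intros eps.
refine (filter_imp _ _ _ (filter_and _ _
  (proj1 (filterlim_locally _ _) Hr eps) (proj1 (filterlim_locally _ _) Hi eps))).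
intros x [H1 H2]; split; assumption.
Qed.

Lemma filterlim_Re {T : Type} {F : (T -> Prop) -> Prop} {FF : Filter F}
    (f : T -> C) (l : C) :
  filterlim f F (locally l) -> filterlim (fun x => Re (f x)) F (locally (Re l)).
Proof.
intros Hf; apply filterlim_locally; intros eps.
refine (filter_imp _ _ _ (proj1 (filterlim_locally (U := C_UniformSpace) _ _) Hf eps)).
intros x [H _]; exact H.
Qed.

Lemma filterlim_Im {T : Type} {F : (T -> Prop) -> Prop} {FF : Filter F}
    (f : T -> C) (l : C) :
  filterlim f F (locally l) -> filterlim (fun x => Im (f x)) F (locally (Im l)).
Proof.
intros Hf; apply filterlim_locally; intros eps.
refine (filter_imp _ _ _ (proj1 (filterlim_locally (U := C_UniformSpace) _ _) Hf eps)).
intros x [_ H]; exact H.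
Qed.

Lemma filterlim_Cmult {T : Type} {F : (T -> Prop) -> Prop} {FF : Filter F}
    (f g : T -> C) (a b : C) :
  filterlim f F (locally a) -> filterlim g F (locally b) ->
  filterlim (fun x => (f x * g x)%C) F (locally (a * b)%C).
Proof.
intros Hf Hg.
assert (fr := filterlim_Re _ _ Hf); assert (fi := filterlim_Im _ _ Hf).
assert (gr := filterlim_Re _ _ Hg); assert (gi := filterlim_Im _ _ Hg).
assert (M : forall (u v : T -> R) x y, filterlim u F (locally x) ->
  filterlim v F (locally y) -> filterlim (fun t => u t * v t) F (locally (x * y))).
{ intros u v x y Hu Hv; exact (filterlim_comp_2 _ _ _ Hu Hv (filterlim_mult (K := R_AbsRing) x y)). }
assert (P : forall (u v : T -> R) x y, filterlim u F (locally x) ->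
  filterlim v F (locally y) -> filterlim (fun t => u t + v t) F (locally (x + y))).
{ intros u v x y Hu Hv; exact (filterlim_comp_2 _ _ _ Hu Hv (filterlim_plus (V := R_NormedModule) x y)). }
assert (O : forall (u : T -> R) x, filterlim u F (locally x) ->
  filterlim (fun t => - u t) F (locally (- x))).
{ intros u x Hu; exact (filterlim_comp _ _ _ _ _ _ _ _ Hu (filterlim_opp (V := R_NormedModule) x)). }
apply filterlim_C; simpl; [apply P; [|apply O]|apply P]; apply M; assumption.
Qed.

Lemma is_RInt_gen_Cmult {Fa Fb : (R -> Prop) -> Prop} {FFa : Filter Fa} {FFb : Filter Fb}
    (c : C) (f : R -> C) (l : C) :
  is_RInt_gen (V := C_R_CompleteNormedModule) f Fa Fb l ->
  is_RInt_gen (V := C_R_CompleteNormedModule) (fun x => Cmult c (f x)) Fa Fb (Cmult c l).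
Proof.
apply (is_RInt_gen_map (U := C_R_NormedModule) (V := C_R_NormedModule) (Cmult c)).
- intros a b l' Hf.
  generalize (is_RInt_fct_extend_fst (U := R_NormedModule) (V := R_NormedModule) f a b l' Hf)
    (is_RInt_fct_extend_snd (U := R_NormedModule) (V := R_NormedModule) f a b l' Hf).
  intros H1 H2.
  apply (is_RInt_fct_extend_pair (U := R_NormedModule) (V := R_NormedModule)); simpl.
  + apply: is_RInt_minus; apply: is_RInt_scal; assumption.
  + apply: is_RInt_plus; apply: is_RInt_scal; assumption.
- apply (linear_cont (U := C_R_NormedModule)), is_linear_Cmult.
Qed.

(* Integrate the derivative of s^z (1 - s)^b over (0, 1). *)
Lemma Beta_succ (z : C) (b : R) : 0 < Re z -> 0 < b ->
  ((z + RtoC b) * Beta z (b + 1) = RtoC b * Beta z b)%C.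
Proof.
intros Hz Hb.
assert (H1 := is_RInt_gen_Cmult (Fa := at_right 0) (Fb := at_left 1) (z + RtoC b)%C _ _
  (is_RInt_gen_Beta z (b + 1) Hz ltac:(lra))).
assert (H2 := is_RInt_gen_Cmult (Fa := at_right 0) (Fb := at_left 1) (RtoC b) _ _ (is_RInt_gen_Beta z b Hz Hb)).
assert (H3 := is_RInt_gen_minus (V := C_R_CompleteNormedModule) (Fa := at_right 0) (Fb := at_left 1) _ _ _ _ H1 H2).
apply is_RInt_gen_unique in H3.
assert (H4 : is_RInt_gen (V := C_R_CompleteNormedModule) (fun s => minus
  ((z + RtoC b) * beta_kernel z (b + 1) s)%C (RtoC b * beta_kernel z b s)%C)
    (at_right 0) (at_left 1) (minus (RtoC 0) (RtoC 0))).
{ apply (is_RInt_gen_primitive (V := C_R_CompleteNormedModule) (fun s => 0 < s < 1)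
    (fun s => (Cpower (RtoC s) z * RtoC (Rpower (1 - s) b))%C)).
  - intros; lra.
  - apply at_right_between; lra.
  - apply at_left_between; lra.
  - intros s Hs; evar_last.
    + apply is_derive_Cmult; [apply is_derive_Cpower; lra|].
      apply is_derive_RtoC, is_derive_Rpower_compl; lra.
    + simpl; unfold beta_kernel; change minus with Cminus.
      replace (b + 1 - 1) with b by ring.
      rewrite (Cpower_step s z); [|lra]; rewrite (Rpower_step (1 - s) b); [|lra].
      rewrite !RtoC_opp ?RtoC_mult ?RtoC_minus; ring.
  - intros s Hs; apply (continuous_minus (V := C_R_NormedModule));
      apply filterlim_Cmult; try exact (continuous_beta_kernel _ _ s Hs); apply: filterlim_const.
  - apply (filterlim_C_zero _ (fun s => Rpower s (Re z))); [|apply filterlim_Rpower_0, Hz].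
    generalize (at_right_between 0 1 Rlt_0_1); apply filter_imp; intros s Hs.
    rewrite Cmod_mult Cmod_Cpower ?Cmod_R; [|lra].
    rewrite Rabs_pos_eq; [|apply Rlt_le, Rpower_pos].
    generalize (Rpower_pos s (Re z)) (Rpower_le_1 (1 - s) b ltac:(lra) ltac:(lra)); nra.
  - apply (filterlim_C_zero _ (fun s => Rpower (1 - s) b)).
    + generalize (at_left_between 0 1 Rlt_0_1); apply filter_imp; intros s Hs.
      rewrite Cmod_mult Cmod_Cpower ?Cmod_R; [|lra].
      rewrite Rabs_pos_eq; [|apply Rlt_le, Rpower_pos].
      generalize (Rpower_pos (1 - s) b) (Rpower_le_1 s (Re z) ltac:(lra) ltac:(lra)); nra.
    + exact (filterlim_Rpower_compl_0 b Hb). }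
apply is_RInt_gen_unique in H4.
assert (E := eq_trans (eq_sym H3) H4); change minus with Cminus in E.
replace (RtoC 0 - RtoC 0)%C with (RtoC 0) in E by ring.
apply (f_equal (fun x => x + RtoC b * Beta z b)%C) in E; ring_simplify in E.
ring_simplify; exact E.
Qed.

(** For b = 1 the kernel times [z] is the derivative of s^z, which goes from 0 to 1. *)
Lemma Beta_1 (z : C) : 0 < Re z -> (z * Beta z 1 = 1)%C.
Proof.
intros Hz.
assert (H1 := is_RInt_gen_Cmult (Fa := at_right 0) (Fb := at_left 1) z _ _ (is_RInt_gen_Beta z 1 Hz ltac:(lra))).
apply is_RInt_gen_unique in H1; rewrite -H1; clear H1.
transitivity (RtoC 1 - RtoC 0)%C; [|ring].
apply (is_RInt_gen_unique (V := C_R_CompleteNormedModule)).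
apply (is_RInt_gen_primitive (V := C_R_CompleteNormedModule) (fun s => 0 < s < 1)
    (fun s => Cpower (RtoC s) z)).
- intros; lra.
- apply at_right_between; lra.
- apply at_left_between; lra.
- intros s Hs; unfold beta_kernel.
  replace (1 - 1) with 0 by ring; rewrite Rpower_O; [|lra].
  evar_last; [apply is_derive_Cpower; lra|simpl; ring].
- intros s Hs; apply filterlim_Cmult; [apply: filterlim_const|].
  exact (continuous_beta_kernel _ _ s Hs).
- apply (filterlim_C_zero _ (fun s => Rpower s (Re z))); [|apply filterlim_Rpower_0, Hz].
  generalize (at_right_between 0 1 Rlt_0_1); apply filter_imp; intros s Hs.
  rewrite Cmod_Cpower; lra.
- replace (RtoC 1) with (Cpower (RtoC 1) z).
  + refine (filterlim_filter_le_1 _ (filter_le_within (T := R) (F := locally 1) (fun u => u < 1)) _).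
    apply: (ex_derive_continuous (V := C_R_NormedModule)).
    eexists; apply is_derive_Cpower; lra.
  + rewrite Cpower_pos ?ln_1 ?Rmult_0_r ?exp_0 ?cos_0 ?sin_0; [|lra].
    unfold RtoC; f_equal; ring.
Qed.

(** * The Gamma integral *)

Lemma ln_le_sub1 (x : R) : 0 < x -> ln x <= x - 1.
Proof.
intros Hx; generalize (exp_ineq1_le (ln x)); rewrite exp_ln //; lra.
Qed.

(** The tangent to ln at [m] gives ln t <= t / m - 1 + ln m. The choice m = 2 |c| + 1 is positive
    and makes |c| / m at most 1/2. *)
Lemma Rpower_le_exp_half (c : R) :
  exists K, 0 < K /\ forall t, 1 <= t -> Rpower t c <= K * exp (- (- (1/2)) * t).
Proof.
set (m := 2 * Rabs c + 1); assert (Hc := Rabs_pos c); assert (Hc' := Rle_abs c).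
exists (exp (Rabs c * ln m)); split; [apply exp_pos|intros t Ht].
unfold Rpower; rewrite -exp_plus; apply exp_le_exp.
assert (Hm : 0 < m) by (unfold m; lra).
assert (H0 : 0 <= ln t) by (rewrite -ln_1; apply ln_le; lra).
assert (H1 : ln t <= t / m - 1 + ln m).
{ replace t with (t / m * m) at 1 by (field; lra).
  assert (Htm : 0 < t / m) by (apply Rdiv_lt_0_compat; lra).
  rewrite ln_mult //; generalize (ln_le_sub1 (t / m) Htm); lra. }
assert (H2 : c * ln t <= Rabs c * ln t) by nra.
assert (H3 : Rabs c * ln t <= Rabs c * (t / m - 1 + ln m)) by (apply Rmult_le_compat_l; assumption).
assert (H4 : Rabs c * (t / m) <= 1 / 2 * t).
{ replace (1 / 2 * t) with (m / 2 * (t / m)) by (field; lra).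
  apply Rmult_le_compat_r; [apply Rlt_le, Rdiv_lt_0_compat; lra|unfold m; lra]. }
lra.
Qed.

Definition gamma_kernel (z : C) (t : R) : C :=
  (RtoC (exp (- t)) * Cpower (RtoC t) (z - 1))%C.

Lemma Cmod_gamma_kernel (z : C) (t : R) :
  0 < t -> Cmod (gamma_kernel z t) = exp (- t) * Rpower t (Re z - 1).
Proof.
intros Ht; unfold gamma_kernel; rewrite Cmod_mult Cmod_Cpower ?Cmod_R; [|lra].
rewrite Rabs_pos_eq; [|apply Rlt_le, exp_pos].
now destruct z.
Qed.

Lemma continuous_gamma_kernel (z : C) (t : R) :
  0 < t -> continuous (U := C_R_NormedModule) (gamma_kernel z) t.
Proof.
intros Ht; apply: ex_derive_continuous; eexists; apply is_derive_Cmult.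
- apply is_derive_RtoC; auto_derive; auto.
- apply is_derive_Cpower; exact Ht.
Qed.

Lemma filterlim_exp_neg (c : R) : c < 0 ->
  filterlim (fun t => exp (c * t)) (Rbar_locally p_infty) (locally 0).
Proof.
intros Hc; eapply filterlim_comp; [|exact is_lim_exp_m].
intros P [M HM]; exists (M / c); intros t Ht; apply HM.
replace M with (c * (M / c)) by (field; lra); nra.
Qed.

(** The primitive is delivered along with its end limits because the truncated integral [Phi N - l0]
    over (0, N) is what gets compared with Beta. Near 0 the exponential is at most 1; near infinity
    half of the exponent absorbs the power. *)
Lemma gamma_primitive (z : C) : 0 < Re z ->
  exists (Phi : R -> C) (l0 l1 : C),
    (forall t, 0 < t -> is_derive (V := C_R_NormedModule) Phi t (gamma_kernel z t)) /\
    filterlim Phi (at_right 0) (locally l0) /\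
    filterlim Phi (Rbar_locally p_infty) (locally l1) /\
    Gamma z = (l1 - l0)%C.
Proof.
intros Hz.
assert (Dc : forall x y z, 0 < x -> 0 < z -> x <= y <= z -> 0 < y) by (intros; lra).
set (Phi := fun x => @RInt C_R_CompleteNormedModule (gamma_kernel z) 1 x).
assert (dPhi : forall x, 0 < x -> is_derive (V := C_R_CompleteNormedModule) Phi x (gamma_kernel z x)).
{ intros x Hx; apply (is_derive_primitive (V := C_R_CompleteNormedModule) (fun x => 0 < x)); auto.
  - apply open_gt.
  - exact (continuous_gamma_kernel z).
  - lra. }
assert (H0 : exists l, filterlim Phi (at_right 0) (locally (l : C_R_CompleteNormedModule))).
{ apply (primitive_limit_dominated (fun x => 0 < x < 1) Phi (gamma_kernel z)
    (fun s => / Re z * Rpower s (Re z)) (fun s => Rpower s (Re z - 1)) 0).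
  - intros; lra.
  - apply at_right_between; lra.
  - intros x Hx; apply dPhi; lra.
  - intros x Hx; apply continuous_gamma_kernel; lra.
  - intros x Hx; evar_last; [apply: is_derive_scal; apply is_derive_Rpower; lra|].
    unfold scal; simpl; unfold mult; simpl; field; lra.
  - intros x Hx; apply: ex_derive_continuous; eexists; apply is_derive_Rpower; lra.
  - intros x Hx; rewrite norm_C Cmod_gamma_kernel; [|lra].
    generalize (Rpower_pos x (Re z - 1)) (exp_le_exp (- x) 0 ltac:(lra)).
    rewrite exp_0; nra.
  - apply filterlim_scal_0, filterlim_Rpower_0, Hz. }
assert (H1 : exists l, filterlim Phi (Rbar_locally p_infty) (locally (l : C_R_CompleteNormedModule))).
{ destruct (Rpower_le_exp_half (Re z - 1)) as [K [HK Hle]].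
  apply (primitive_limit_dominated (fun x => 1 < x) Phi (gamma_kernel z)
    (fun s => - (2 * K) * exp (- (1/2) * s)) (fun s => K * exp (- (1/2) * s)) 0).
  - intros; lra.
  - exists 1; auto.
  - intros x Hx; apply dPhi; lra.
  - intros x Hx; apply continuous_gamma_kernel; lra.
  - intros x Hx; auto_derive; auto; field.
  - intros x Hx; apply: ex_derive_continuous; auto_derive; auto.
  - intros x Hx; rewrite norm_C Cmod_gamma_kernel; [|lra].
    replace (exp (- (1/2) * x)) with (exp (- x) * exp (- (- (1/2)) * x))
      by (rewrite -exp_plus; f_equal; field).
    generalize (Hle x ltac:(lra)) (exp_pos (- x)); nra.
  - apply filterlim_scal_0, filterlim_exp_neg; lra. }
destruct H0 as [l0 H0], H1 as [l1 H1]; exists Phi, l0, l1.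
split; [exact dPhi|split; [exact H0|split; [exact H1|]]].
rewrite Gamma_Euler //; unfold Gamma_integral.
apply (is_RInt_gen_unique (V := C_R_CompleteNormedModule)).
apply (is_RInt_gen_primitive (V := C_R_CompleteNormedModule) (fun x => 0 < x) Phi); auto.
- generalize (at_right_between 0 1 Rlt_0_1); apply filter_imp; intros; lra.
- exists 0; auto.
- exact (continuous_gamma_kernel z).
Qed.

(** * The limit of N^z B(z, N + 1) *)

(** The factor s^2 will yield a gain of 1 / N, and the exponential keeps the error comparable to a
    Gamma integral. For s >= 1/2 already 1 <= 4 N s^2; below 1/2 the estimate ln (1 - s) >= - s - 2
    s^2 suffices. *)
Lemma exp_minus_power_bound (N s : R) : 1 <= N -> 0 < s < 1 ->
  Rabs (exp (- (N * s)) - Rpower (1 - s) N) <= 4 * N * s ^ 2 * exp (- (N * s)).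
Proof.
intros HN Hs.
assert (H1 : Rpower (1 - s) N <= exp (- (N * s))).
{ unfold Rpower; apply exp_le_exp; generalize (ln_le_sub1 (1 - s) ltac:(lra)); nra. }
rewrite Rabs_pos_eq; [|lra].
assert (He := exp_pos (- (N * s))); assert (Hp := Rpower_pos (1 - s) N).
destruct (Rle_dec (1/2) s) as [Hs2|Hs2].
{ assert (1 <= 4 * N * s ^ 2); [|nra].
  assert (1/4 <= s ^ 2) by nra; nra. }
(* 1 - s = (1 - s^2) / (1 + s), with 1 + s <= e^s *)
assert (H2 : - s - 2 * s ^ 2 <= ln (1 - s)).
{ assert (Ha : ln (1 + s) <= s) by (generalize (ln_le_sub1 (1 + s) ltac:(lra)); lra).
  assert (Hy : 0 < / (1 - s ^ 2)) by (apply Rinv_0_lt_compat; nra).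
  assert (Hb : ln (/ (1 - s ^ 2)) <= 2 * s ^ 2).
  { eapply Rle_trans; [apply ln_le_sub1, Hy|].
    replace (/ (1 - s ^ 2) - 1) with (s ^ 2 * / (1 - s ^ 2)) by (field; nra).
    assert (/ (1 - s ^ 2) <= 2); [|nra].
    rewrite -(Rinv_inv 2); apply Rinv_le_contravar; nra. }
  rewrite ln_Rinv in Hb; [|nra].
  replace (1 - s ^ 2) with ((1 - s) * (1 + s)) in Hb by ring.
  rewrite ln_mult in Hb; lra. }
assert (H3 : exp (- (N * s)) * (1 - 2 * N * s ^ 2) <= Rpower (1 - s) N).
{ apply Rle_trans with (exp (- (N * s)) * exp (- (2 * N * s ^ 2))).
  - apply Rmult_le_compat_l; [lra|]; generalize (exp_ineq1_le (- (2 * N * s ^ 2))); lra.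
  - rewrite -exp_plus; unfold Rpower; apply exp_le_exp; nra. }
assert (0 <= N * s ^ 2 * exp (- (N * s))); [|nra].
apply Rmult_le_pos; [nra|lra].
Qed.

Lemma gamma_kernel_mult (N s : R) (z : C) : 0 < N -> 0 < s ->
  (RtoC N * gamma_kernel z (N * s) =
   Cpower (RtoC N) z * (RtoC (exp (- (N * s))) * Cpower (RtoC s) (z - 1)))%C.
Proof.
intros HN Hs; unfold gamma_kernel; rewrite RtoC_mult Cpower_scale // (Cpower_step N z) //; ring.
Qed.

Lemma is_derive_primitive_scale (Phi : R -> C) (z : C) (N s : R) : 0 < N -> 0 < s ->
  (forall t, 0 < t -> is_derive (V := C_R_NormedModule) Phi t (gamma_kernel z t)) ->
  is_derive (V := C_R_NormedModule) (fun s => Phi (N * s)) s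
    (RtoC N * gamma_kernel z (N * s))%C.
Proof.
intros HN Hs dPhi.
evar_last.
- apply (is_derive_comp (K := R_AbsRing) (V := C_R_NormedModule) Phi (fun s => N * s) s).
  + apply dPhi; nra.
  + apply: (is_derive_scal (fun s => s) s N 1); apply: is_derive_id.
- destruct (gamma_kernel z (N * s)) as [x y].
  unfold scal; simpl; unfold prod_scal, scal, mult; simpl; unfold mult; simpl.
  unfold Cmult; simpl; f_equal; ring.
Qed.

Lemma filterlim_scale_at_right (N : R) : 0 < N ->
  filterlim (fun s => N * s) (at_right 0) (at_right 0).
Proof.
intros HN P [d Hd]; exists (mkposreal _ (Rdiv_lt_0_compat _ _ (cond_pos d) HN)).
intros y Hy Hy0; apply Hd; [|nra].
unfold ball in *; simpl in *; unfold AbsRing_ball, abs, minus, plus, opp in *; simpl in *.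
rewrite Ropp_0 Rplus_0_r in Hy; rewrite Ropp_0 Rplus_0_r Rabs_mult (Rabs_pos_eq N); [|lra].
replace (pos d) with (N * (d / N)) by (field; lra); nra.
Qed.

(** The substitution u = N s is carried out on the primitive, as s |-> Phi (N s). *)
Lemma is_RInt_gen_gamma_scaled (Phi : R -> C) (z l0 : C) (N : R) : 0 < N ->
  (forall t, 0 < t -> is_derive (V := C_R_NormedModule) Phi t (gamma_kernel z t)) ->
  filterlim Phi (at_right 0) (locally l0) ->
  is_RInt_gen (V := C_R_CompleteNormedModule)
    (fun s => (RtoC N * gamma_kernel z (N * s))%C) (at_right 0) (at_left 1)
    (Phi N - l0)%C.
Proof.
intros HN dPhi Hl.
apply (is_RInt_gen_primitive (V := C_R_CompleteNormedModule) (fun s => 0 < s < 1)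
  (fun s => Phi (N * s))).
- intros; lra.
- apply at_right_between; lra.
- apply at_left_between; lra.
- intros s Hs; apply is_derive_primitive_scale; auto; lra.
- intros s Hs; apply filterlim_Cmult; [apply: filterlim_const|].
  eapply (continuous_comp (fun s => N * s) (gamma_kernel z)).
  + apply: (ex_derive_continuous (fun s => N * s)); auto_derive; auto.
  + apply continuous_gamma_kernel; nra.
- exact (filterlim_comp _ _ _ _ _ _ _ _ (filterlim_scale_at_right N HN) Hl).
- replace (Phi N) with (Phi (N * 1)) by (f_equal; ring).
  refine (filterlim_filter_le_1 _ (filter_le_within (T := R) (F := locally 1) (fun u => u < 1)) _).
  apply: (ex_derive_continuous (V := C_R_NormedModule)).
  eexists; apply is_derive_primitive_scale; [exact HN|lra|exact dPhi].
Qed.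

Lemma gamma_kernel_real (x t : R) : 0 < t ->
  gamma_kernel (RtoC x) t = RtoC (exp (- t) * Rpower t (x - 1)).
Proof.
intros Ht; unfold gamma_kernel; rewrite RtoC_mult -Cpower_real //.
now rewrite RtoC_minus.
Qed.

(* Substituting u = N s in the Gamma integral over (0, N) turns the two integrals
   into integrals of e^(-N s) and (1 - s)^N against N^z s^(z - 1) over (0, 1). By
   [exp_minus_power_bound] the difference is 4 / N times a Gamma integral at
   [Re z + 2]. *)
Lemma Cpower_Beta_bound (z : C) (N : R) (Phi Psi : R -> C) (l0 m0 : C) :
  0 < Re z -> 1 <= N ->
  (forall t, 0 < t -> is_derive (V := C_R_NormedModule) Phi t (gamma_kernel z t)) ->
  filterlim Phi (at_right 0) (locally l0) ->
  (forall t, 0 < t -> is_derive (V := C_R_NormedModule) Psi t (gamma_kernel (RtoC (Re z + 2)) t)) ->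
  filterlim Psi (at_right 0) (locally m0) ->
  Cmod (Phi N - l0 - Cpower (RtoC N) z * Beta z (N + 1))%C
    <= 4 / N * (Re (Psi N) - Re m0).
Proof.
intros Hz HN dPhi Hl dPsi Hm.
assert (H1 := is_RInt_gen_gamma_scaled Phi z l0 N ltac:(lra) dPhi Hl).
assert (H2 := is_RInt_gen_Cmult (Fa := at_right 0) (Fb := at_left 1)
  (Cpower (RtoC N) z) _ _ (is_RInt_gen_Beta z (N + 1) Hz ltac:(lra))).
assert (H3 := is_RInt_gen_minus (V := C_R_CompleteNormedModule)
  (Fa := at_right 0) (Fb := at_left 1) _ _ _ _ H1 H2).
assert (H4 := is_RInt_gen_gamma_scaled Psi _ m0 N ltac:(lra) dPsi Hm).
assert (H5 : is_RInt_gen (V := R_NormedModule)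
  (fun s => 4 / N * Re (RtoC N * gamma_kernel (RtoC (Re z + 2)) (N * s))%C)
  (at_right 0) (at_left 1) (4 / N * (Re (Psi N) - Re m0))).
{ apply: is_RInt_gen_scal.
  apply (is_RInt_gen_map (U := C_R_NormedModule) (V := R_NormedModule) Re
    (fun s => (RtoC N * gamma_kernel (RtoC (Re z + 2)) (N * s))%C) (Psi N - m0)%C).
  - intros a b l Hab.
    exact (is_RInt_fct_extend_fst (U := R_NormedModule) (V := R_NormedModule) _ a b l Hab).
  - apply: linear_cont; apply: is_linear_fst.
  - exact H4. }
assert (HD : filter_prod (at_right 0) (at_left 1)
  (fun ab => 0 < fst ab < 1 / 2 /\ 1 / 2 < snd ab < 1)).
{ exists (fun x => 0 < x < 1 / 2) (fun x => 1 / 2 < x < 1); auto.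
  - apply at_right_between; lra.
  - apply at_left_between; lra. }
rewrite -norm_C.
refine (RInt_gen_norm (V := C_R_CompleteNormedModule) (Fa := at_right 0) (Fb := at_left 1)
  _ _ _ _ _ _ H3 H5).
- revert HD; apply filter_imp; intros ab Hab; lra.
- revert HD; apply filter_imp; intros ab Hab s Hs.
  assert (Hs' : 0 < s < 1) by lra.
  rewrite gamma_kernel_mult; [|lra|lra].
  rewrite gamma_kernel_real; [|nra].
  set (u := (RtoC (exp (- (N * s))) - RtoC (Rpower (1 - s) N))%C).
  replace (minus _ _) with (Cpower (RtoC N) z * Cpower (RtoC s) (z - 1) * u)%C.
  2:{ unfold beta_kernel, u; replace (N + 1 - 1) with N by ring.
      change minus with Cminus; simpl; ring. }
  rewrite norm_C !Cmod_mult !Cmod_Cpower; [|lra|lra].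
  unfold u; rewrite -RtoC_minus Cmod_R.
  rewrite -RtoC_mult; simpl.
  replace (fst z + - (1)) with (Re z - 1) by (unfold Re; ring).
  (* The shift by 2 in the Gamma argument produces the s^2 of the error bound. *)
  replace (Re z + 2 - 1) with (1 + 1 + (Re z - 1)) by ring.
  replace (Rpower (N * s) (1 + 1 + (Re z - 1)))
    with (N * s ^ 2 * (Rpower N (Re z) * Rpower s (Re z - 1))).
  2:{ rewrite (Rpower_plus (1 + 1)) (Rpower_plus 1 1) !Rpower_1; [|nra].
      rewrite -Rpower_mult_distr; [|lra|lra].
      rewrite (Rpower_step N (Re z)); [ring|lra]. }
  assert (Hb := exp_minus_power_bound N s HN Hs').
  assert (Hp := Rmult_lt_0_compat _ _ (Rpower_pos N (Re z)) (Rpower_pos s (Re z - 1))).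
  set (X := Rpower N (Re z) * Rpower s (Re z - 1)) in *.
  replace (4 / N * (N * (exp (- (N * s)) * (N * s ^ 2 * X))))
    with (X * (4 * N * s ^ 2 * exp (- (N * s)))) by (field; lra).
  apply Rmult_le_compat_l; [lra|exact Hb].
Qed.

(** [Phi N - l0] tends to Gamma z. Its distance to the Beta term is at most 4 / N times a truncated
    Gamma integral, which converges, so the distance tends to 0. *)
Lemma filterlim_Cpower_Beta (z : C) : 0 < Re z ->
  filterlim (fun N => (Cpower (RtoC N) z * Beta z (N + 1))%C)
    (Rbar_locally p_infty) (locally (Gamma z)).
Proof.
intros Hz.
destruct (gamma_primitive z Hz) as [Phi [l0 [l1 [dPhi [H0 [H1 HG]]]]]].
assert (Hz2 : 0 < Re (RtoC (Re z + 2))) by (simpl; lra).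
destruct (gamma_primitive _ Hz2) as [Psi [m0 [m1 [dPsi [K0 [K1 _]]]]]].
set (e := fun N => (Phi N - l0 - Cpower (RtoC N) z * Beta z (N + 1))%C).
assert (He : filterlim e (Rbar_locally p_infty) (locally (RtoC 0))).
{ apply (filterlim_C_zero _ (fun N => 4 * / N * (Re (Psi N) - Re m0))).
  - exists 1; intros N HN; apply Cpower_Beta_bound; auto; lra.
  - replace 0 with (4 * 0 * (Re m1 - Re m0)) by ring.
    refine (filterlim_comp_2 _ _ _ _ _ (filterlim_mult (K := R_AbsRing) _ _)).
    + refine (filterlim_comp _ _ _ _ _ _ _ _ _ (filterlim_scal_r 4 0)).
      exact (filterlim_Rbar_inv p_infty ltac:(discriminate)).
    + refine (filterlim_comp_2 _ _ _ _ _ (filterlim_plus (V := R_NormedModule) _ _)).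
      * exact (filterlim_Re _ _ K1).
      * apply: filterlim_const. }
assert (E : forall N, (Cpower (RtoC N) z * Beta z (N + 1) = Phi N + (- l0 + - (1) * e N))%C)
  by (intros N; unfold e; ring).
apply (filterlim_ext _ _ (fun N => eq_sym (E N))).
replace (Gamma z) with (l1 + (- l0 + - (1) * RtoC 0))%C by (rewrite HG; ring).
refine (filterlim_comp_2 _ _ _ H1 _ (filterlim_plus (V := C_R_NormedModule) _ _)).
refine (filterlim_comp_2 _ _ _ _ _ (filterlim_plus (V := C_R_NormedModule) _ _)).
- apply: filterlim_const.
- apply filterlim_Cmult; [apply: filterlim_const|exact He].
Qed.

(** * Gauss's product, and the absence of zeros of Gamma *)

(** Iterates [Beta_succ] from [Beta_1]. The n + 1 factors z, ..., z + n in the denominator of B(z, n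
    + 1) are those of Gauss's product. *)
Lemma Beta_rising (z : C) (n : nat) : 0 < Re z ->
  (rising z (S n) * Beta z (INR n + 1) = RtoC (INR (fact n)))%C.
Proof.
intros Hz; induction n as [|n IH].
- simpl; rewrite Rplus_0_l Cplus_0_r Cmult_1_l; exact (Beta_1 z Hz).
- change (rising z (S (S n))) with (rising z (S n) * (z + RtoC (INR (S n))))%C.
  assert (E := Beta_succ z (INR n + 1) Hz ltac:(generalize (pos_INR n); lra)).
  rewrite -S_INR in E, IH |- *.
  rewrite -Cmult_assoc E Cmult_assoc (Cmult_comm (rising _ _)) -Cmult_assoc IH.
  rewrite -RtoC_mult -mult_INR; reflexivity.
Qed.

(** |z + m|^2 = m^2 (1 + 2 Re z / m + |z|^2 / m^2), then 1 + x <= e^x; the square root halves the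
    exponent. *)
Lemma Cmod_add_nat_bound (z : C) (m : R) : 0 < m ->
  Cmod (z + RtoC m) <= m * exp (Re z / m + Cmod z ^ 2 / (2 * m ^ 2)).
Proof.
intros Hm.
assert (He := exp_pos (Re z / m + Cmod z ^ 2 / (2 * m ^ 2))).
apply Rsqr_incr_0_var; [|nra].
replace (Rsqr (Cmod (z + RtoC m)%C)) with (m ^ 2 * (1 + (2 * Re z / m + Cmod z ^ 2 / m ^ 2))).
- rewrite Rsqr_mult; unfold Rsqr; rewrite -exp_plus.
  replace (m * m) with (m ^ 2) by ring; apply Rmult_le_compat_l; [nra|].
  eapply Rle_trans; [apply exp_ineq1_le|apply Req_le]; f_equal; field; lra.
- destruct z as [x y]; unfold Cmod, Rsqr; simpl.
  rewrite !Rmult_1_r !sqrt_sqrt; [field; apply Rgt_not_eq, Hm| |];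
    apply Rplus_le_le_0_compat; apply Rle_0_sqr.
Qed.

(* By [Cmod_add_nat_bound] the factor z + m contributes exp (Re z / m), absorbed
   by 1 / m <= ln m - ln (m - 1), and exp (|z|^2 / (2 m^2)), absorbed by
   1 / (2 m^2) <= 1 / m - 1 / (m + 1). *)
Lemma Cmod_rising_bound (z : C) (n : nat) : 0 < Re z -> (1 <= n)%nat ->
  Cmod (rising z (S n)) <=
    Cmod z * INR (fact n) * Rpower (INR n) (Re z)
      * exp (Re z + Cmod z ^ 2 * (1 - / (INR n + 1))).
Proof.
intros Hz Hn; induction Hn as [|n Hn IH].
(* The case n = 1 fixes the constants: the factor z + 1 contributes exp (Re z + |z|^2 / 2), and 1 -
   1 / (n + 1) is 1/2. *)
- simpl fact; simpl INR; change (rising z 2) with (1 * (z + RtoC 0) * (z + RtoC 1))%C.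
  rewrite Cmod_mult Cmult_1_l Cplus_0_r.
  replace (Rpower 1 (Re z)) with 1 by (unfold Rpower; rewrite ln_1 Rmult_0_r exp_0; reflexivity).
  assert (H := Cmod_add_nat_bound z 1 Rlt_0_1).
  rewrite Rmult_1_l in H; rewrite !Rmult_1_r; apply Rmult_le_compat_l; [apply Cmod_ge_0|].
  eapply Rle_trans; [exact H|apply Req_le]; f_equal; field.
- change (rising z (S (S n))) with (rising z (S n) * (z + RtoC (INR (S n))))%C.
  assert (Hn0 : 1 <= INR n) by (apply (le_INR 1); exact Hn).
  set (m := INR (S n)); assert (Em : m = INR n + 1) by apply S_INR.
  rewrite Cmod_mult; change (fact (S n)) with (S n * fact n)%nat; rewrite mult_INR; fold m.
  assert (H := Cmod_add_nat_bound z m ltac:(lra)).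
  eapply Rle_trans; [apply Rmult_le_compat; [apply Cmod_ge_0|apply Cmod_ge_0|exact IH|exact H]|].
  set (c := Cmod z) in *; set (x := Re z) in *; rewrite -Em.
  assert (Hf := INR_fact_lt_0 n).
  assert (Hc : 0 <= c) by apply Cmod_ge_0.
  replace (c * INR (fact n) * Rpower (INR n) x * exp (x + c ^ 2 * (1 - / m))
     * (m * exp (x / m + c ^ 2 / (2 * m ^ 2))))
   with (c * (m * INR (fact n)) * (Rpower (INR n) x * (exp (x + c ^ 2 * (1 - / m))
     * exp (x / m + c ^ 2 / (2 * m ^ 2))))) by ring.
  replace (c * (m * INR (fact n)) * Rpower m x * exp (x + c ^ 2 * (1 - / (m + 1))))
    with (c * (m * INR (fact n)) * (Rpower m x * exp (x + c ^ 2 * (1 - / (m + 1))))) by ring.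
  apply Rmult_le_compat_l; [apply Rmult_le_pos; [exact Hc|nra]|].
  unfold Rpower; rewrite -!exp_plus; apply exp_le_exp.
  assert (Hl : ln (INR n) <= ln m - / m).
  { replace (INR n) with (m * (INR n / m)) by (field; lra).
    assert (0 < INR n / m) by (apply Rdiv_lt_0_compat; lra).
    rewrite ln_mult; [|lra|lra].
    generalize (ln_le_sub1 (INR n / m) ltac:(lra)).
    replace (INR n / m - 1) with (- / m); [lra|].
    rewrite Em; field; lra. }
  assert (Hs : - / m + / (2 * m ^ 2) <= - / (m + 1)).
  { apply Rminus_le.
    replace (- / m + / (2 * m ^ 2) - - / (m + 1)) with ((1 - m) * / (2 * m ^ 2 * (m + 1)))
      by (field; lra).
    assert (0 < / (2 * m ^ 2 * (m + 1))); [apply Rinv_0_lt_compat; nra|nra]. }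
  assert (Hx : x * ln (INR n) <= x * (ln m - / m)) by (apply Rmult_le_compat_l; lra).
  assert (Hcs : c ^ 2 * (- / m + / (2 * m ^ 2)) <= c ^ 2 * - / (m + 1))
    by (apply Rmult_le_compat_l; [nra|exact Hs]).
  unfold Rdiv; lra.
Qed.

Lemma gauss_filterlim (z : C) : 0 < Re z ->
  filterlim (fun n => (Cpower (RtoC (INR n)) z * Beta z (INR n + 1))%C)
    eventually (locally (Gamma z)).
Proof.
intros Hz; exact (filterlim_comp _ _ _ INR _ _ _ _ is_lim_seq_INR (filterlim_Cpower_Beta z Hz)).
Qed.

(** A zero would make |n^z B(z, n + 1)| tend to 0. But n! is |[rising z (S n)]| |B(z, n + 1)|, hence
    at most n! n^(Re z) K |B(z, n + 1)|, so the modulus stays above 1 / K. Here [K] is the bound on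
    the rising product with its only remaining dependence on n, the term - |z|^2 / (n + 1),
    dropped. *)
Lemma Gamma_neq_0 (z : C) : 0 < Re z -> Gamma z <> RtoC 0.
Proof.
intros Hz H0; assert (Hl := gauss_filterlim z Hz); rewrite H0 in Hl.
assert (Hcz : 0 < Cmod z).
{ apply Cmod_gt_0; intros E; rewrite E in Hz; simpl in Hz; lra. }
set (K := Cmod z * exp (Re z + Cmod z ^ 2)).
assert (HK : 0 < K) by (apply Rmult_lt_0_compat; [exact Hcz|apply exp_pos]).
assert (Heps : 0 < / K) by (apply Rinv_0_lt_compat, HK).
assert (Hn : is_lim_seq (fun n => Cmod (Cpower (RtoC (INR n)) z * Beta z (INR n + 1))%C) 0).
{ rewrite -Cmod_0 -norm_C.
  apply (filterlim_ext (fun n => norm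
    (V := C_R_NormedModule) (Cpower (RtoC (INR n)) z * Beta z (INR n + 1))%C));
    [intros n; apply norm_C|].
  exact (filterlim_comp _ _ _ _ _ _ _ _ Hl (filterlim_norm (V := C_R_NormedModule) (RtoC 0))). }
assert (Hle : Rbar_le (/ K) 0); [|simpl in Hle; lra].
refine (is_lim_seq_le_loc (fun _ => / K) _ (/ K) 0 _ (is_lim_seq_const _) Hn).
exists 1%nat; intros n Hn1.
assert (Hp : 0 < INR n) by (apply lt_0_INR; lia).
assert (E := f_equal Cmod (Beta_rising z n Hz)).
assert (Hb := Cmod_rising_bound z n Hz Hn1).
rewrite Cmod_mult Cmod_R Rabs_pos_eq in E; [|apply pos_INR].
rewrite Cmod_mult Cmod_Cpower //.
assert (Hf := INR_fact_lt_0 n); assert (HB := Cmod_ge_0 (Beta z (INR n + 1))).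
set (B := Cmod (Beta z (INR n + 1))) in *.
set (P := Rpower (INR n) (Re z)) in *; assert (HP : 0 < P) by apply Rpower_pos.
assert (Hx : exp (Re z + Cmod z ^ 2 * (1 - / (INR n + 1))) <= exp (Re z + Cmod z ^ 2)).
{ apply exp_le_exp; assert (0 < / (INR n + 1)) by (apply Rinv_0_lt_compat; lra); nra. }
assert (Hb2 : Cmod (rising z (S n)) <= INR (fact n) * (P * K)).
{ eapply Rle_trans; [exact Hb|]; unfold K.
  replace (INR (fact n) * (P * (Cmod z * exp (Re z + Cmod z ^ 2))))
    with (Cmod z * INR (fact n) * P * exp (Re z + Cmod z ^ 2)) by ring.
  apply Rmult_le_compat_l; [|exact Hx].
  apply Rlt_le; repeat apply Rmult_lt_0_compat; assumption. }
assert (H1 : INR (fact n) * 1 <= INR (fact n) * (P * B * K)).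
{ rewrite Rmult_1_r -{1}E.
  replace (INR (fact n) * (P * B * K)) with (INR (fact n) * (P * K) * B) by ring.
  apply Rmult_le_compat_r; assumption. }
apply Rmult_le_reg_l in H1; [|exact Hf].
apply (Rmult_le_reg_r K); [exact HK|rewrite Rinv_l; lra].
Qed.

(** * The Beta-Gamma relation *)

(** Telescopes [Beta_succ] over b, ..., b + n - 1, which ties B(z, b) to a large second argument,
    where the limit applies. *)
Lemma rising_Beta_shift (z : C) (b : R) (n : nat) : 0 < Re z -> 0 < b ->
  (rising (RtoC b) n * Beta z b = rising (z + RtoC b) n * Beta z (b + INR n))%C.
Proof.
intros Hz Hb; induction n as [|n IH].
- simpl; rewrite Rplus_0_r; reflexivity.
- simpl rising.
  assert (Hn := pos_INR n).
  assert (E := Beta_succ z (b + INR n) Hz ltac:(lra)).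
  rewrite S_INR -(Rplus_assoc b) -Cmult_assoc (Cmult_comm (RtoC b + _)) Cmult_assoc IH.
  rewrite -Cmult_assoc -(Cmult_assoc (rising (z + RtoC b) n)); f_equal.
  rewrite RtoC_plus in E; rewrite -Cplus_assoc E; ring.
Qed.

Lemma rising_neq_0 (z : C) (n : nat) : 0 < Re z -> rising z n <> RtoC 0.
Proof.
intros Hz; induction n as [|n IH]; simpl; [exact C1_nz|].
apply Cmult_neq_0; [exact IH|].
intros E; apply (f_equal fst) in E; simpl in E; generalize (pos_INR n).
unfold Re in Hz; lra.
Qed.

(** With N = n + b, the identity B(z, b) n^(z + b) B(z + b, n + 1) = n^b B(b, n + 1) (n / N)^z N^z
    B(z, N + 1) is exact for n >= 1, by Gauss's product at z + b and at b and the shift in the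
    second argument. Both sides converge, and (n / N)^z tends to 1. *)
Lemma Beta_Gamma (z : C) (b : R) : 0 < Re z -> 0 < b ->
  (Beta z b * Gamma (z + RtoC b) = Gamma z * Gamma (RtoC b))%C.
Proof.
intros Hz Hb.
assert (Hzb : 0 < Re (z + RtoC b)) by (destruct z; simpl in *; lra).
set (a := fun (w : C) n => (Cpower (RtoC (INR n)) w * Beta w (INR n + 1))%C).
set (N := fun n => INR n + b).
set (r := fun n => Cpower (RtoC (INR n / N n)) z).
assert (E : forall n, (1 <= n)%nat -> (Beta z b * a (z + RtoC b)%C n =
  a (RtoC b) n * (r n * (Cpower (RtoC (N n)) z * Beta z (N n + 1))))%C).
{ intros n Hn; assert (Hn0 : 0 < INR n) by (apply lt_0_INR; lia).
  assert (HN : 0 < N n) by (unfold N; lra).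
  rewrite (Cmult_assoc (r n)); unfold r; rewrite -Cpower_scale;
    [|apply Rdiv_lt_0_compat; assumption|exact HN].
  rewrite -RtoC_mult.
  replace (INR n / N n * N n) with (INR n) by (field; lra).
  unfold a; rewrite Cpower_plus.
  assert (E1 := Beta_rising (z + RtoC b) n Hzb).
  assert (E2 := Beta_rising (RtoC b) n Hb).
  assert (E3 := rising_Beta_shift z b (S n) Hz Hb).
  rewrite S_INR in E3; replace (b + (INR n + 1)) with (N n + 1) in E3 by (unfold N; ring).
  set (r1 := rising (z + RtoC b) (S n)) in *; set (r2 := rising (RtoC b) (S n)) in *.
  assert (R1 : r1 <> RtoC 0) by (apply rising_neq_0, Hzb).
  assert (R2 : r2 <> RtoC 0) by (apply rising_neq_0, Hb).
  apply (f_equal (fun u => u / r2)%C) in E3.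
  replace (r2 * Beta z b / r2)%C with (Beta z b) in E3 by (field; exact R2).
  apply (f_equal (fun u => u / r1)%C) in E1.
  replace (r1 * Beta (z + RtoC b) (INR n + 1) / r1)%C with (Beta (z + RtoC b) (INR n + 1)) in E1
    by (field; exact R1).
  apply (f_equal (fun u => u / r2)%C) in E2.
  replace (r2 * Beta (RtoC b) (INR n + 1) / r2)%C with (Beta (RtoC b) (INR n + 1)) in E2
    by (field; exact R2).
  rewrite E1 E2 E3; field; split; assumption. }
assert (HN : filterlim N eventually (Rbar_locally p_infty)).
{ apply (is_lim_seq_plus INR (fun _ => b) p_infty b p_infty is_lim_seq_INR (is_lim_seq_const b)).
  reflexivity. }
assert (Hr : filterlim r eventually (locally (RtoC 1))).
{ replace (RtoC 1) with (Cpower (RtoC 1) z).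
  2:{ rewrite Cpower_pos ?ln_1 ?Rmult_0_r ?exp_0 ?cos_0 ?sin_0; [|lra].
      unfold RtoC; f_equal; ring. }
  apply (filterlim_comp _ _ _ (fun n => INR n / N n) (fun u => Cpower (RtoC u) z) _ (locally 1)).
  - change (is_lim_seq (fun n => INR n / N n) 1).
    apply (is_lim_seq_ext_loc (fun n => 1 - b * / N n)).
    + exists 1%nat; intros n Hn; unfold N; generalize (pos_INR n); intros; field; lra.
    + replace (Finite 1) with (Finite (1 - b * 0)) by (f_equal; ring).
      apply is_lim_seq_minus'; [apply is_lim_seq_const|].
      apply: (is_lim_seq_scal_l _ b 0).
      apply (is_lim_seq_inv N p_infty HN); discriminate.
  - apply: (ex_derive_continuous (V := C_R_NormedModule)).
    eexists; apply is_derive_Cpower; lra. }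
assert (L1 : filterlim (fun n => Beta z b * a (z + RtoC b) n)%C eventually
  (locally (Beta z b * Gamma (z + RtoC b))%C)).
{ apply filterlim_Cmult; [apply: filterlim_const|exact (gauss_filterlim _ Hzb)]. }
assert (L2 : filterlim (fun n => Beta z b * a (z + RtoC b) n)%C eventually
  (locally (Gamma z * Gamma (RtoC b))%C)).
{ apply: (filterlim_ext_loc (fun n =>
    a (RtoC b) n * (r n * (Cpower (RtoC (N n)) z * Beta z (N n + 1))))%C).
  - exists 1%nat; intros n Hn; symmetry; exact (E n Hn).
  - replace (Gamma z * Gamma (RtoC b))%C with (Gamma (RtoC b) * (1 * Gamma z))%C by ring.
    apply filterlim_Cmult; [exact (gauss_filterlim (RtoC b) Hb)|].
    apply filterlim_Cmult; [exact Hr|].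
    exact (filterlim_comp _ _ _ _ _ _ _ _ HN (filterlim_Cpower_Beta z Hz)). }
exact (filterlim_locally_unique (V := C_R_NormedModule) _ _ _ L1 L2).
Qed.

Lemma Gamma_1 : Gamma (RtoC 1) = RtoC 1.
Proof.
rewrite Gamma_Euler; [unfold Gamma_integral|simpl; lra].
transitivity (RtoC 0 - RtoC (- exp (- 0)))%C.
2:{ rewrite Ropp_0 exp_0; unfold RtoC, Cminus, Cplus, Copp; simpl; f_equal; ring. }
apply (is_RInt_gen_unique (V := C_R_CompleteNormedModule)).
apply (is_RInt_gen_primitive (V := C_R_CompleteNormedModule) (fun x => 0 < x)
  (fun t => RtoC (- exp (- t)))).
- intros; lra.
- generalize (at_right_between 0 1 Rlt_0_1); apply filter_imp; intros; lra.
- exists 0; auto.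
- intros t Ht; evar_last; [apply is_derive_RtoC; auto_derive; auto|].
  replace (RtoC 1 - RtoC 1)%C with (RtoC 0) by ring.
  rewrite Cpower_real // Rpower_O //; simpl; rewrite -RtoC_mult; f_equal; ring.
- intros t Ht; exact (continuous_gamma_kernel (RtoC 1) t Ht).
- refine (filterlim_filter_le_1 _ (filter_le_within (T := R) (F := locally 0) (fun u => 0 < u)) _).
  apply (ex_derive_continuous (V := C_R_NormedModule) (fun t => RtoC (- exp (- t))) 0).
  eexists; apply is_derive_RtoC; auto_derive; auto.
- apply (filterlim_C_zero _ (fun t => exp (- (1) * t))); [|apply filterlim_exp_neg; lra].
  exists 0; intros t Ht; rewrite Cmod_R Rabs_Ropp Rabs_pos_eq; [|apply Rlt_le, exp_pos].
  apply Req_le; f_equal; ring.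
Qed.

(** The case b = 1 of [Beta_Gamma], where z B(z, 1) = 1 and Gamma(1) = 1. *)
Lemma Gamma_succ (z : C) : 0 < Re z -> Gamma (z + 1) = (z * Gamma z)%C.
Proof.
intros Hz; assert (E := Beta_Gamma z 1 Hz Rlt_0_1); rewrite Gamma_1 in E.
apply (f_equal (Cmult z)) in E; rewrite Cmult_assoc (Beta_1 z Hz) in E.
rewrite Cmult_1_l Cmult_1_r in E; exact E.
Qed.

(** * The Riemann-Liouville derivative of a power *)

Lemma is_RInt_gen_rescale (f : R -> R) (l u : R) : 0 < u ->
  is_RInt_gen f (at_right 0) (at_left 1) l ->
  is_RInt_gen (fun x => f (x / u)) (at_right 0) (at_left u) (u * l).
Proof.
intros Hu Hf P HP.
assert (Hd : forall (e : posreal) (a x : R), ball (a * u) (u * e) x -> ball a e (x / u)).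
{ intros e a x; unfold ball; simpl; unfold AbsRing_ball, abs, minus, plus, opp; simpl.
  replace (x + - (a * u)) with (u * (x / u + - a)) by (field; lra).
  rewrite Rabs_mult (Rabs_pos_eq u); [|lra]; intros H.
  exact (Rmult_lt_reg_l _ _ _ Hu H). }
assert (cL : filterlim (fun y => u * y) (locally l) (locally (u * l)))
  by exact (filterlim_scal_r (K := R_AbsRing) (V := R_NormedModule) u l).
destruct (Hf _ (cL P HP)) as [Q1 Q2 [e1 H1] [e2 H2] HQ].
exists (fun x => Q1 (x / u)) (fun x => Q2 (x / u)).
- exists (mkposreal _ (Rmult_lt_0_compat _ _ Hu (cond_pos e1))); intros y Hy Hy0.
  apply H1; [apply Hd; rewrite Rmult_0_l; exact Hy|apply Rdiv_lt_0_compat; assumption].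
- exists (mkposreal _ (Rmult_lt_0_compat _ _ Hu (cond_pos e2))); intros y Hy Hy0.
  apply H2; [apply Hd; rewrite Rmult_1_l; exact Hy|].
  apply Rlt_div_l; [exact Hu|rewrite Rmult_1_l; exact Hy0].
- intros a b Ha Hb; destruct (HQ _ _ Ha Hb) as [y [Hy Py]]; simpl in Hy.
  exists (u * y); split; [|exact Py]; simpl.
  assert (E : forall x, x / u = / u * x + 0) by (intros; field; lra).
  rewrite !E in Hy.
  apply is_RInt_comp_lin in Hy.
  apply (is_RInt_scal _ _ _ u) in Hy.
  revert Hy; apply is_RInt_ext; intros x _.
  unfold scal; simpl; unfold mult; simpl; rewrite E; field; lra.
Qed.

Lemma is_RInt_gen_Beta_real (a b : R) : 0 < a -> 0 < b ->
  is_RInt_gen (fun s => Rpower s (a - 1) * Rpower (1 - s) (b - 1))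
    (at_right 0) (at_left 1) (Re (Beta (RtoC a) b)).
Proof.
intros Ha Hb.
apply (is_RInt_gen_ext (fun s => Re (beta_kernel (RtoC a) b s))).
- exists (fun x => 0 < x < 1) (fun x => 0 < x < 1).
  + apply at_right_between; lra.
  + apply at_left_between; lra.
  + intros x y Hx Hy s Hs; simpl in Hs; unfold beta_kernel.
    assert (0 < s) by (generalize (Rmin_glb_lt x y 0); lra).
    rewrite -RtoC_minus Cpower_real // -RtoC_mult; reflexivity.
- apply (is_RInt_gen_map (U := C_R_NormedModule) (V := R_NormedModule) Re).
  + intros c d l Hcd.
    exact (is_RInt_fct_extend_fst (U := R_NormedModule) (V := R_NormedModule) _ c d l Hcd).
  + apply: linear_cont; apply: is_linear_fst.
  + exact (is_RInt_gen_Beta (RtoC a) b Ha Hb).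
Qed.

(** [RL_derivative] integrates in [R] and [Beta] in [C]; they can be matched because the imaginary
    part is an integral of zero. *)
Lemma Beta_real (a b : R) : 0 < a -> 0 < b ->
  Beta (RtoC a) b = RtoC (Re (Beta (RtoC a) b)).
Proof.
intros Ha Hb; apply injective_projections; [reflexivity|simpl].
assert (H1 : is_RInt_gen (fun _ => 0) (at_right 0) (at_left 1) (Im (Beta (RtoC a) b))).
{ apply (is_RInt_gen_ext (fun s => Im (beta_kernel (RtoC a) b s))).
  - exists (fun x => 0 < x < 1) (fun x => 0 < x < 1).
    + apply at_right_between; lra.
    + apply at_left_between; lra.
    + intros x y Hx Hy s Hs; simpl in Hs; unfold beta_kernel.
      assert (0 < s) by (generalize (Rmin_glb_lt x y 0); lra).
      rewrite -RtoC_minus Cpower_real // -RtoC_mult; reflexivity.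
  - apply (is_RInt_gen_map (U := C_R_NormedModule) (V := R_NormedModule) Im).
    + intros c d l Hcd.
      exact (is_RInt_fct_extend_snd (U := R_NormedModule) (V := R_NormedModule) _ c d l Hcd).
    + apply: linear_cont; apply: is_linear_snd.
    + exact (is_RInt_gen_Beta (RtoC a) b Ha Hb). }
assert (H2 : is_RInt_gen (V := R_CompleteNormedModule) (fun _ => 0)
  (at_right 0) (at_left 1) (minus 0 0)).
{ apply (is_RInt_gen_primitive (V := R_CompleteNormedModule) (fun s => 0 < s < 1) (fun _ => 0)).
  - intros; lra.
  - apply at_right_between; lra.
  - apply at_left_between; lra.
  - intros; apply: is_derive_const.
  - intros; apply: continuous_const.
  - apply: filterlim_const.
  - apply: filterlim_const. }
apply (is_RInt_gen_unique (V := R_CompleteNormedModule)) in H1, H2.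
change (Im (Beta (RtoC a) b) = 0); rewrite -H1 H2; apply: minus_eq_zero.
Qed.

(** With s = u x the integrand is u^(mu - alpha) times the Beta kernel at x; the change of variable
    adds one more factor [u]. *)
Lemma is_RInt_gen_RL_power (alpha mu u : R) : alpha < 1 -> -1 < mu -> 0 < u ->
  is_RInt_gen (fun s => Rpower (u - s) (- alpha) * Rpower s mu) (at_right 0) (at_left u)
    (Rpower u (mu + 1 - alpha) * Re (Beta (RtoC (mu + 1)) (1 - alpha))).
Proof.
intros Ha Hm Hu.
assert (H := is_RInt_gen_Beta_real (mu + 1) (1 - alpha) ltac:(lra) ltac:(lra)).
apply (is_RInt_gen_rescale _ _ u Hu) in H.
apply (is_RInt_gen_scal _ (Rpower u (mu - alpha))) in H.
replace (Rpower u (mu + 1 - alpha) * Re (Beta (RtoC (mu + 1)) (1 - alpha)))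
  with (scal (Rpower u (mu - alpha)) (u * Re (Beta (RtoC (mu + 1)) (1 - alpha)))).
2:{ rewrite (Rpower_step u (mu + 1 - alpha)) //.
    replace (mu + 1 - alpha - 1) with (mu - alpha) by ring.
    unfold scal; simpl; unfold mult; simpl; ring. }
revert H; apply is_RInt_gen_ext.
exists (fun x => 0 < x < u) (fun x => 0 < x < u).
- apply at_right_between; lra.
- apply at_left_between; lra.
- intros x y Hx Hy s Hs; simpl in Hs; unfold scal; simpl; unfold mult; simpl.
  assert (0 < s) by (generalize (Rmin_glb_lt x y 0); lra).
  assert (s < u) by (generalize (Rmax_lub_lt x y u); lra).
  assert (Hsu : 0 < s / u) by (apply Rdiv_lt_0_compat; lra).
  assert (H1u : 0 < 1 - s / u).
  { replace (1 - s / u) with ((u - s) / u) by (field; lra); apply Rdiv_lt_0_compat; lra. }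
  replace (mu + 1 - 1) with mu by ring; replace (1 - alpha - 1) with (- alpha) by ring.
  replace (mu - alpha) with (mu + - alpha) by ring; rewrite Rpower_plus.
  replace (u - s) with (u * (1 - s / u)) by (field; lra).
  rewrite -(Rpower_mult_distr u) //.
  replace (Rpower s mu) with (Rpower u mu * Rpower (s / u) mu).
  + ring.
  + rewrite Rpower_mult_distr //; f_equal; field; lra.
Qed.

(** The integral is a multiple of a power of [u] for all u > 0, hence near [t], which is all that
    [Derive] sees. The value is left in terms of [Beta], so the sign of mu + 1 - alpha does not
    matter yet. *)
Lemma RL_derivative_power (alpha mu t : R) : alpha < 1 -> -1 < mu -> 0 < t ->
  RL_derivative alpha (fun s => Rpower s mu) t =
  (/ Gamma (RtoC (1 - alpha)) * (RtoC (mu + 1 - alpha) * RtoC (Rpower t (mu - alpha))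
    * Beta (RtoC (mu + 1)) (1 - alpha)))%C.
Proof.
intros Ha Hm Ht; unfold RL_derivative; f_equal.
rewrite Beta_real; [|lra|lra]; rewrite -!RtoC_mult; f_equal.
rewrite (Derive_ext_loc _ (fun u => Rpower u (mu + 1 - alpha) *
  Re (Beta (RtoC (mu + 1)) (1 - alpha)))).
- rewrite Derive_scal_l; f_equal.
  apply is_derive_unique; evar_last; [apply is_derive_Rpower, Ht|].
  f_equal; f_equal; ring.
- refine (filter_imp _ _ _ (open_gt 0 t Ht)); intros u Hu.
  apply (is_RInt_gen_unique (V := R_CompleteNormedModule)).
  exact (is_RInt_gen_RL_power alpha mu u Ha Hm Hu).
Qed.

(** * The fractional integral at complex points *)

(** The factor [z] of [segment_integral] stays beside z^(mu + alpha - 1), the product form that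
    [is_derive_path_power] differentiates. *)
Lemma V_integral_power (gamma beta rho delta : C) (p q alpha mu : R) (z : C) :
  0 < alpha -> -1 < mu -> 0 < Re z ->
  V_integral gamma beta rho delta p q alpha (fun x => Cpower (z - x) (RtoC mu)) z =
  (Gamma (gamma + beta) * pochhammer delta p / (Gamma beta * pochhammer rho q)
    * Beta (RtoC alpha) (mu + 1) * (z * Cpower z (RtoC (mu + alpha - 1))))%C.
Proof.
intros Ha Hm Hz; unfold V_integral, segment_integral.
rewrite -Cmult_assoc; f_equal.
rewrite Cmult_assoc (Cmult_comm (Beta _ _)) -Cmult_assoc; f_equal.
apply (is_RInt_gen_unique (V := C_R_CompleteNormedModule)).
assert (H := is_RInt_gen_Cmult (Fa := at_right 0) (Fb := at_left 1)
  (Cpower z (RtoC (mu + alpha - 1))) _ _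
  (is_RInt_gen_Beta (RtoC alpha) (mu + 1) Ha ltac:(lra))).
rewrite Cmult_comm; revert H; apply (is_RInt_gen_ext (V := C_R_CompleteNormedModule)).
exists (fun x => 0 < x < 1) (fun x => 0 < x < 1).
- apply at_right_between; lra.
- apply at_left_between; lra.
- intros x y Hx Hy s Hs; simpl in Hs.
  assert (0 < s) by (generalize (Rmin_glb_lt x y 0); lra).
  assert (s < 1) by (generalize (Rmax_lub_lt x y 1); lra).
  replace (z - RtoC s * z)%C with (RtoC (1 - s) * z)%C by (rewrite RtoC_minus; ring).
  rewrite !Cpower_scale //; [|lra].
  unfold beta_kernel; rewrite -RtoC_minus -Cpower_real; [|lra].
  replace (mu + 1 - 1) with mu by ring.
  replace (mu + alpha - 1) with (mu + (alpha - 1)) by ring.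
  rewrite RtoC_plus Cpower_plus.
  as_C_eq; ring.
Qed.

(** * Differentiation of powers along a complex path *)

Lemma is_derive_C_quotient (f : R -> C) (l : C) :
  is_derive (V := C_R_NormedModule) f 0 l ->
  filterlim (fun eps => (f eps - f 0)%C / RtoC eps)%C (locally' 0) (locally l).
Proof.
intros Hf.
assert (H : forall (g : R -> R) d, is_derive g 0 d ->
  filterlim (fun eps => (g eps - g 0) / eps) (locally' 0) (locally d)).
{ intros g d Hg; apply is_derive_Reals in Hg; apply filterlim_locally; intros eps.
  destruct (Hg eps (cond_pos eps)) as [e He]; exists e; intros y Hy Hy0.
  unfold ball in *; simpl in *; unfold AbsRing_ball, abs, minus, plus, opp in *; simpl in *.
  rewrite Ropp_0 Rplus_0_r in Hy.
  specialize (He y Hy0 Hy); rewrite Rplus_0_l in He; exact He. }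
assert (E : forall (z : C) e, e <> 0 -> (z / RtoC e)%C = (Re z / e, Im z / e)).
{ intros [x y] e He; unfold Cdiv; rewrite -RtoC_inv //.
  unfold Cmult, Rdiv; simpl; f_equal; ring. }
assert (Hne : locally' 0 (fun e => e <> 0)) by (exists (mkposreal 1 Rlt_0_1); auto).
apply (filterlim_ext_loc (fun e => (Re (f e - f 0)%C / e, Im (f e - f 0)%C / e))).
- revert Hne; apply filter_imp; intros e He; symmetry; exact (E _ e He).
- apply filterlim_C; simpl.
  + exact (H _ _ (is_derive_Re _ _ _ Hf)).
  + exact (H _ _ (is_derive_Im _ _ _ Hf)).
Qed.

(** Elementary real functions of the coordinates, ready for automatic differentiation; ln |z|
    appears as half of ln |z|^2 to avoid the square root. *)
Lemma Cpower_right_half_plane (z : C) (c : R) : 0 < Re z ->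
  Cpower z (RtoC c) =
    (exp (c * (ln (Re z ^ 2 + Im z ^ 2) / 2)) * cos (c * atan (Im z / Re z)),
     exp (c * (ln (Re z ^ 2 + Im z ^ 2) / 2)) * sin (c * atan (Im z / Re z))).
Proof.
intros Hz; unfold Cpower, Cln, Carg.
destruct (Rlt_dec 0 (Re z)) as [_|H]; [|lra].
assert (E : ln (Cmod z) = ln (Re z ^ 2 + Im z ^ 2) / 2).
{ assert (Hp : 0 < Cmod z)
    by (apply Cmod_gt_0; intros E; rewrite E in Hz; simpl in Hz; lra).
  replace (Re z ^ 2 + Im z ^ 2) with (Cmod z * Cmod z).
  - rewrite ln_mult //; field.
  - unfold Cmod; rewrite sqrt_sqrt; [reflexivity|].
    apply Rplus_le_le_0_compat; apply pow2_ge_0. }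
rewrite E; unfold Cexp, Cmult, RtoC; simpl.
rewrite !Rmult_0_l Rminus_0_r Rplus_0_r; reflexivity.
Qed.

(** At the real point [t] the complex derivative of z^c is the real number c t^(c - 1), so each
    component of the velocity is merely scaled by it. *)
Lemma is_derive_polar_power (U V : R -> R) (u' v' t c : R) : 0 < t ->
  U 0 = t -> V 0 = 0 -> is_derive U 0 u' -> is_derive V 0 v' ->
  is_derive (fun e => exp (c * (ln (U e ^ 2 + V e ^ 2) / 2)) * cos (c * atan (V e / U e))) 0
    (c * Rpower t (c - 1) * u') /\
  is_derive (fun e => exp (c * (ln (U e ^ 2 + V e ^ 2) / 2)) * sin (c * atan (V e / U e))) 0
    (c * Rpower t (c - 1) * v').
Proof.
intros Ht HU HV dU dV.
assert (DU := is_derive_unique _ _ _ dU); assert (DV := is_derive_unique _ _ _ dV).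
assert (Hln : ln (t * (t * 1) + 0 * (0 * 1)) / 2 = ln t).
{ replace (t * (t * 1) + 0 * (0 * 1)) with (t * t) by ring; rewrite ln_mult //; field. }
assert (Hexp : exp (c * ln t) = t * Rpower t (c - 1)) by (rewrite -Rpower_step //; reflexivity).
assert (H0 : 0 / t = 0) by (field; lra).
assert (HdU : ex_derive (fun x => U x) 0) by (exists u'; exact dU).
assert (HdV : ex_derive (fun x => V x) 0) by (exists v'; exact dV).
assert (Hdom : 0 < U 0 * (U 0 * 1) + V 0 * (V 0 * 1) /\ U 0 <> 0) by (rewrite HU HV; split; [nra|lra]).
assert (E1 : Derive (fun x => U x) 0 = u') by exact DU.
assert (E2 : Derive (fun x => V x) 0 = v') by exact DV.
split; auto_derive; try tauto;
  rewrite E1 E2 HU HV; change (0 * / t) with (0 / t); rewrite H0;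
  change (ln (t * (t * 1) + 0 * (0 * 1)) * / 2) with (ln (t * (t * 1) + 0 * (0 * 1)) / 2);
  rewrite Hln Hexp atan_0 Rmult_0_r cos_0 sin_0; field; lra.
Qed.

Lemma is_derive_path_power (w : R -> C) (w' : C) (t c : R) : 0 < t ->
  w 0 = RtoC t -> is_derive (V := C_R_NormedModule) w 0 w' ->
  is_derive (V := C_R_NormedModule) (fun e => (w e * Cpower (w e) (RtoC c))%C) 0
    (RtoC ((c + 1) * Rpower t c) * w')%C.
Proof.
intros Ht H0 Hw.
assert (Hr := is_derive_Re _ _ _ Hw); assert (Hi := is_derive_Im _ _ _ Hw).
assert (Hpos : locally 0 (fun e => 0 < Re (w e))).
{ assert (Hc : continuous (fun e => Re (w e)) 0)
    by (apply: ex_derive_continuous; eexists; exact Hr).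
  apply (Hc (fun y => 0 < y)); rewrite H0; exact (open_gt 0 t Ht). }
evar_last.
- apply is_derive_Cmult; [exact Hw|].
  apply (is_derive_ext_loc (V := C_R_NormedModule)
    (fun e => (exp (c * (ln (Re (w e) ^ 2 + Im (w e) ^ 2) / 2)) * cos (c * atan (Im (w e) / Re (w e))),
     exp (c * (ln (Re (w e) ^ 2 + Im (w e) ^ 2) / 2)) * sin (c * atan (Im (w e) / Re (w e)))))).
  + revert Hpos; apply filter_imp; intros e He; symmetry.
    exact (Cpower_right_half_plane (w e) c He).
  + destruct (is_derive_polar_power (fun e => Re (w e)) (fun e => Im (w e)) (Re w') (Im w') t c)
      as [D1 D2]; auto; try (rewrite H0; reflexivity).
    apply (is_derive_C _ _ (c * Rpower t (c - 1) * Re w', c * Rpower t (c - 1) * Im w'));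
      [exact D1|exact D2].
- cbv beta; rewrite H0 Cpower_real // (Rpower_step t c) //.
  unfold Cmult, Cplus, RtoC; simpl; unfold Re, Im; f_equal; ring.
Qed.

(** * Value and velocity of the truncated function at 0 *)

(** Every term except k = 1 has derivative 0 at 0, and 1 <= i puts that term in the sum. *)
Lemma is_derive_truncH (i : nat) (gamma beta rho delta : C) (p q tau : R) : (1 <= i)%nat ->
  is_derive (V := C_R_NormedModule)
    (fun e => truncH i gamma beta rho delta p q (RtoC (e * tau))) 0
    (Gamma beta * (pochhammer rho q / pochhammer delta p * (RtoC tau / Gamma (gamma + beta))))%C.
Proof.
intros Hi; unfold truncH.
set (a := fun k : nat => (pochhammer rho (q * INR k) / pochhammer delta (p * INR k))%C).
set (d := fun k : nat => Gamma (gamma * RtoC (INR k) + beta)).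
assert (Hpow : forall k (x : R), Cpow (RtoC x) k = RtoC (x ^ k)).
{ intros k x; induction k as [|k IH]; simpl; [reflexivity|rewrite IH RtoC_mult; reflexivity]. }
set (D := fun k : nat => match k with 1%nat => (a 1%nat * (RtoC tau / d 1%nat))%C | _ => RtoC 0 end).
assert (Hterm : forall k, is_derive (V := C_R_NormedModule)
  (fun e => (a k * (Cpow (RtoC (e * tau)) k / d k))%C) 0 (D k)).
{ intros k.
  apply (is_derive_ext (V := C_R_NormedModule)
    (fun e => (RtoC ((e * tau) ^ k) * (a k / d k))%C)).
  - intros e; rewrite Hpow; unfold Cdiv.
    as_C_eq; ring.
  - evar_last.
    + apply is_derive_Cmult; [|apply: is_derive_const].
      apply is_derive_RtoC; auto_derive; auto.
    + change (@zero C_R_NormedModule) with (RtoC 0).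
      destruct k as [|[|k]]; unfold D; simpl; rewrite ?Rmult_0_l ?Rmult_0_r ?Rmult_1_r ?Rmult_1_l;
        unfold Cdiv; as_C_eq; ring. }
assert (Hsum : forall j, is_derive (V := C_R_NormedModule)
  (fun e => sum_n (fun k => (a k * (Cpow (RtoC (e * tau)) k / d k))%C) j) 0
  (match j with O => RtoC 0 | _ => D 1%nat end)).
{ intros j; induction j as [|j IH].
  - apply (is_derive_ext (V := C_R_NormedModule) (fun e => (a 0%nat * (Cpow (RtoC (e * tau)) 0 / d 0%nat))%C)).
    + intros e; rewrite sum_O; reflexivity.
    + exact (Hterm 0%nat).
  - apply (is_derive_ext (V := C_R_NormedModule)
      (fun e => plus (sum_n (fun k => (a k * (Cpow (RtoC (e * tau)) k / d k))%C) j)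
        (a (S j) * (Cpow (RtoC (e * tau)) (S j) / d (S j)))%C)).
    + intros e; rewrite sum_Sn; reflexivity.
    + evar_last; [apply (is_derive_plus (V := C_R_NormedModule)); [exact IH|exact (Hterm (S j))]|].
      destruct j as [|j]; [apply: plus_zero_l|apply: plus_zero_r]. }
evar_last.
- apply is_derive_Cmult; [apply: is_derive_const|exact (Hsum i)].
- destruct i as [|i]; [lia|]; unfold D, a, d; simpl INR; rewrite !Rmult_1_r Cmult_1_r.
  change (@zero C_R_NormedModule) with (RtoC 0).
  as_C_eq; ring.
Qed.

(** Only k = 0 survives; its Pochhammer symbols are quotients Gamma / Gamma, equal to 1 because
    Gamma does not vanish there. *)
Lemma truncH_0 (i : nat) (gamma beta rho delta : C) (p q : R) :
  0 < Re beta -> 0 < Re rho -> 0 < Re delta ->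
  truncH i gamma beta rho delta p q (RtoC 0) = RtoC 1.
Proof.
intros Hb Hr Hd; unfold truncH.
assert (Gb := Gamma_neq_0 _ Hb); assert (Gr := Gamma_neq_0 _ Hr); assert (Gd := Gamma_neq_0 _ Hd).
replace (sum_n _ i) with (/ Gamma beta)%C; [field; exact Gb|].
induction i as [|i IH].
- rewrite sum_O; simpl INR; unfold pochhammer.
  rewrite !Rmult_0_r !Cplus_0_r Cmult_0_r Cplus_0_l; simpl.
  as_C_eq; field; repeat split; assumption.
- rewrite sum_Sn -IH.
  replace (Cpow (RtoC 0) (S i)) with (RtoC 0) by (simpl; ring).
  change plus with Cplus; unfold Cdiv; rewrite Cmult_0_l Cmult_0_r; ring.
Qed.

Lemma pochhammer_neq_0 (a : C) (s : R) : 0 < Re a -> 0 < s -> pochhammer a s <> RtoC 0.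
Proof.
intros Ha Hs E; apply (Gamma_neq_0 (a + RtoC s)); [simpl; unfold Re in Ha; lra|].
replace (Gamma (a + RtoC s)) with (pochhammer a s * Gamma a)%C.
- rewrite E; ring.
- unfold pochhammer; field; exact (Gamma_neq_0 a Ha).
Qed.

(** For i = 0 the truncated function is constantly 1 and the derivative would be 0. At mu + 1 -
    alpha = 0 the right-hand side pairs a pole of Gamma with a vanishing D^alpha t^mu. *)
Theorem theorem21 (gamma beta rho delta : C) (p q alpha mu : R) (i : nat)
    (t : R) :
  0 < Re gamma -> 0 < Re beta -> 0 < Re rho -> 0 < Re delta ->
  0 < p -> 0 < q -> q <= Re gamma + p ->
  0 < alpha < 1 -> (1 <= i)%nat -> -1 < mu ->
  mu + 1 - alpha <> 0 ->
  0 < t ->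
  is_V_derivative i gamma beta rho delta p q alpha
    (fun z : C =>
       V_integral gamma beta rho delta p q alpha
         (fun x : C => Cpower (z - x)%C (RtoC mu)) z)
    t
    (Gamma (RtoC (mu + 1 - alpha)) * Gamma (RtoC alpha)
       / Gamma (RtoC (mu + 1 + alpha))
     * RtoC (Rpower t alpha) * RtoC (mu + alpha)
     * RL_derivative alpha (fun s : R => Rpower s mu) t)%C.
Proof.
intros Hg Hb Hr Hd Hp Hq _ Ha Hi Hm Hy Ht; unfold is_V_derivative.
assert (Gb := Gamma_neq_0 _ Hb).
assert (Ggb : Gamma (gamma + beta) <> RtoC 0)
  by (apply Gamma_neq_0; unfold Re in *; simpl; lra).
assert (Pr := pochhammer_neq_0 rho q Hr Hq); assert (Pd := pochhammer_neq_0 delta p Hd Hp).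
set (tau := Rpower t (- alpha)); set (c := mu + alpha - 1).
set (w := fun e => (RtoC t * truncH i gamma beta rho delta p q (RtoC (e * tau)))%C).
set (A := (Gamma (gamma + beta) * pochhammer delta p / (Gamma beta * pochhammer rho q)
  * Beta (RtoC alpha) (mu + 1))%C).
set (w' := (RtoC t * (Gamma beta * (pochhammer rho q / pochhammer delta p
  * (RtoC tau / Gamma (gamma + beta)))))%C).
assert (w0 : w 0 = RtoC t).
{ unfold w; rewrite Rmult_0_l truncH_0 //; ring. }
assert (dw : is_derive (V := C_R_NormedModule) w 0 w').
{ evar_last; [apply is_derive_Cmult; [apply: is_derive_const|exact (is_derive_truncH i gamma beta rho delta p q tau Hi)]|].
  change (@zero C_R_NormedModule) with (RtoC 0); unfold w'.
  as_C_eq; ring. }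
assert (df : is_derive (V := C_R_NormedModule) (fun e => (A * (w e * Cpower (w e) (RtoC c)))%C) 0
  (A * (RtoC ((c + 1) * Rpower t c) * w'))%C).
{ evar_last; [apply is_derive_Cmult; [apply: is_derive_const|exact (is_derive_path_power w w' t c Ht w0 dw)]|].
  cbv beta; change (@zero C_R_NormedModule) with (RtoC 0).
  as_C_eq; ring. }
apply is_derive_C_quotient in df; cbv beta in df; rewrite w0 in df.
assert (Hpos : locally 0 (fun e => 0 < Re (w e))).
{ assert (Hc : continuous (fun e => Re (w e)) 0)
    by (apply: ex_derive_continuous; eexists; exact (is_derive_Re _ _ _ dw)).
  apply (Hc (fun y => 0 < y)); rewrite w0; exact (open_gt 0 t Ht). }
assert (EB : forall a b : R, 0 < a -> 0 < b ->
  Beta (RtoC a) b = (Gamma (RtoC a) * Gamma (RtoC b) / Gamma (RtoC (a + b)))%C).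
{ intros a b Ka Kb; rewrite -Beta_Gamma // RtoC_plus; field.
  apply Gamma_neq_0; simpl; lra. }
(* The recursion Gamma(w + 1) = w Gamma(w) at w = mu + 1 - alpha, which may be negative but exceeds
   -1. *)
assert (EG : Gamma (RtoC (mu + 1 + (1 - alpha))) =
  (RtoC (mu + 1 - alpha) * Gamma (RtoC (mu + 1 - alpha)))%C).
{ destruct (Rlt_dec 0 (mu + 1 - alpha)) as [Hy0|Hy0].
  - rewrite -(Gamma_succ (RtoC (mu + 1 - alpha)) Hy0) -RtoC_plus; f_equal; f_equal; ring.
  - assert (Es : Gamma_shift (RtoC (mu + 1 - alpha)) = 1%nat).
    { unfold Gamma_shift; simpl Re.
      (* Here - w lies in [0, 1), so [up] gives 1 and the definition of [Gamma] divides by w after a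
         single unit step. *)
      rewrite -(tech_up (- (mu + 1 - alpha)) 1); [reflexivity|simpl; lra|simpl; lra]. }
    unfold Gamma at 2; rewrite Es; simpl rising; simpl INR.
    rewrite -RtoC_plus Gamma_Euler; [|simpl; lra].
    replace (mu + 1 - alpha + 1) with (mu + 1 + (1 - alpha)) by ring.
    field; intros E; apply Hy; exact (RtoC_inj _ _ E). }
assert (El : (A * (RtoC ((c + 1) * Rpower t c) * w'))%C =
  (Gamma (RtoC (mu + 1 - alpha)) * Gamma (RtoC alpha)
       / Gamma (RtoC (mu + 1 + alpha))
     * RtoC (Rpower t alpha) * RtoC (mu + alpha)
     * RL_derivative alpha (fun s : R => Rpower s mu) t)%C).
{ assert (G1 : Gamma (RtoC (1 - alpha)) <> RtoC 0) by (apply Gamma_neq_0; simpl; lra).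
  assert (G2 : Gamma (RtoC (mu + 1 + alpha)) <> RtoC 0) by (apply Gamma_neq_0; simpl; lra).
  assert (G3 : Gamma (RtoC (mu + 1 + (1 - alpha))) <> RtoC 0) by (apply Gamma_neq_0; simpl; lra).
  assert (G4 : Gamma (RtoC (mu + 1 - alpha)) <> RtoC 0).
  { intros E; apply G3; rewrite EG E; ring. }
  assert (G5 : RtoC (mu + 1 - alpha) <> RtoC 0) by (intros E; apply Hy; exact (RtoC_inj _ _ E)).
  rewrite RL_derivative_power; [|lra|lra|exact Ht].
  unfold A, w'; rewrite !EB; [|lra|lra|lra|lra].
  replace (alpha + (mu + 1)) with (mu + 1 + alpha) by ring; rewrite EG.
  (* Both sides equal t^mu, since [c] is mu + alpha - 1 and [tau] is t^(- alpha). *)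
  assert (ET : (RtoC (Rpower t c) * RtoC t * RtoC tau)%C =
    (RtoC (Rpower t alpha) * RtoC (Rpower t (mu - alpha)))%C).
  { rewrite -!RtoC_mult; f_equal; rewrite -(Rpower_plus alpha).
    rewrite -{2}(Rpower_1 t Ht); unfold tau; rewrite -!Rpower_plus; f_equal; unfold c; ring. }
  replace (c + 1) with (mu + alpha) by (unfold c; ring); rewrite RtoC_mult.
  transitivity (Gamma (RtoC alpha) * Gamma (RtoC (mu + 1)) / Gamma (RtoC (mu + 1 + alpha))
    * RtoC (mu + alpha) * (RtoC (Rpower t c) * RtoC t * RtoC tau))%C.
  - field; repeat split; assumption.
  - rewrite ET; field; repeat split; assumption. }
rewrite -El; revert df; apply filterlim_ext_loc.
(* The closed form of the integral holds only where Re > 0; the path stays there for small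
   increments, which is all that the limit sees. *)
destruct Hpos as [e He]; exists e; intros y Hy1 _.
rewrite !V_integral_power; [|lra|lra|exact Ht|lra|lra|exact (He y Hy1)].
reflexivity.
Qed.
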